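(* Suppose there exists a set $C\in\mathcal B$ with $\mu(C)<\infty$ such that: (1.1) $f_*=\inf_{x,y\in C}f_1(y|x)>0$; (1.2) there exists a (Lyapunov) function $\mathbf V:\mathcal X\to[1,\infty)$ such that $\mathbf V(x)\ge\widetilde g(x)$ for all $x\in\mathcal X$ and $\mathbf V^*=\sup_{x\in C}\mathbf V(x)<\infty$; (1.3) for some $0<\rho<1$ and $D>0$ and for all $x\in\mathcal X$, $\mathsf E_{x,0}\mathbf V(X_1)\le(1-\rho)\mathbf V(x)+D\,\mathbf 1_C(x)$. Suppose also that there exists $\mathbf r>2$ such that $$\sup_{k\ge1}\mathsf E_\infty\,g^*_{\mathbf r}(X_k)<\infty\quad\text{and}\quad\sup_{k\ge1}\mathsf E_\infty\,\upsilon^*_{\mathbf r}(X_k)<\infty,$$ where $g^*_{\mathbf r}(x)=\sup_{n\ge1}\mathsf E_{x,0}|g(X_n,X_{n-1})|^{\mathbf r}$ and $\upsilon^*_{\mathbf r}(x)=\sup_{n\ge0}\mathsf E_{x,0}[\mathbf V(X_n)]^{\mathbf r}$. Then, with $I=\lambda(\widetilde g)=\int_{\mathcal X}\widetilde g(x)\,\lambda(dx)$, $$\sum_{n=1}^\infty\sup_{k\ge0}\mathsf P_k\Big\{\Big|\frac1nZ^k_{k+n}-I\Big|>\varepsilon\Big\}<\infty\quad\text{for all }\varepsilon>0.$$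
   Context: $(\mathcal X,\mathcal B)$ is a measurable space with a sigma-finite positive measure $\mu$. For a change point $\nu\in\{0,1,2,\dots\}\cup\{\infty\}$, the observed sequence $(X_n)$ with initial value $X_0$ (whose law does not depend on $\nu$) is, under $\mathsf P_\nu$ (expectation $\mathsf E_\nu$), a Markov process on $\mathcal X$ such that the transition from $X_{n-1}=x$ to $X_n=y$ has density $f_0(y|x)$ with respect to $\mu$ for $n\le\nu$ and density $f_1(y|x)$ with respect to $\mu$ for $n>\nu$ ($\nu=\infty$: always $f_0$). The homogeneous Markov process with transition density $f_1$ is positive ergodic with stationary (invariant) probability distribution $\lambda$. $\mathsf P_{x,0}(\cdot)=\mathsf P_0(\cdot\mid X_0=x)$, with expectation $\mathsf E_{x,0}$, is the law of the chain with transition density $f_1$ started at $X_0=x$. Put $$g(y,x)=\log\frac{f_1(y|x)}{f_0(y|x)},\qquad Z^k_n=\sum_{j=k+1}^ng(X_j,X_{j-1})\ (0\le k<n),\qquad \widetilde g(x)=\int_{\mathcal X}g(y,x)f_1(y|x)\,\mu(dy),$$ where $g:\mathcal X\times\mathcal X\to\mathbb R$ is measurable and the integrals defining $\widetilde g$ and $\lambda(\widetilde g)$ are assumed to exist.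
   Formalization: The expectation of V(X_0) under the law of the initial value X_0 is additionally assumed finite; without it the k=0 term can diverge (f_0=φ(y), f_1=φ(y−x/2) with φ the normal density, V=1+x², E X_0²=∞). *)

(* Defs.v *)
From HB Require Import structures.
From mathcomp Require Import all_boot all_order all_algebra.
From mathcomp Require Import all_classical all_reals all_analysis.
Import Order.TTheory GRing.Theory Num.Theory.
Import numFieldNormedType.Exports.

Set Implicit Arguments.
Unset Strict Implicit.
Unset Printing Implicit Defensive.

Local Open Scope classical_set_scope.
Local Open Scope ring_scope.

(* Densities are written [f y x] for f(y|x): the arrival point comes first. *)
Definition transition_density (d : measure_display) (T : measurableType d)
    (R : realType) (mu : {measure set T -> \bar R}) (f : T -> T -> R) : Prop :=
  [/\ measurable_fun [set: T * T] (fun p => f p.1 p.2),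
      forall x y, 0 <= f y x
    & forall x, (\int[mu]_y (f y x)%:E = 1)%E].

(* The sigma-algebra sigma(X_0, ..., X_n). *)
Definition history (d' d : measure_display) (Om : measurableType d')
    (T : measurableType d) (X : nat -> {mfun Om >-> T}) (n : nat) :
    set (set Om) :=
  <<s \bigcup_(i in [set i | (i <= n)%N])
        preimage_set_system setT (X i) measurable >>.

(* Under [P], the process [X] is Markov with initial law [init], the transition
   from X_(n-1) to X_n having density [p n] with respect to [mu]:
     P(X_(n+1) \in B | X_0, ..., X_n) = \int_B p_(n+1)(y | X_n) mu(dy)  a.s.,
   the conditional probability being spelled out by its defining property. *)
Definition markov_law (d' d : measure_display) (Om : measurableType d')
    (T : measurableType d) (R : realType) (mu : {measure set T -> \bar R})
    (P : probability Om R) (X : nat -> {mfun Om >-> T})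
    (init : set T -> \bar R) (p : nat -> T -> T -> R) : Prop :=
  (forall B, measurable B -> P (X 0%N @^-1` B) = init B) /\
  (forall n F B, history X n F -> measurable B ->
    (P (F `&` X n.+1 @^-1` B) =
     \int[P]_(w in F) \int[mu]_(y in B) (p n.+1 y (X n w))%:E)%E).

(* Density of the n-th transition (n >= 1) when the change point is [nu];
   [None] stands for nu = infinity. *)
Definition change_density (S : Type) (f0 f1 : S) (nu : option nat) (n : nat) :
    S :=
  if nu is Some k then (if (n <= k)%N then f0 else f1) else f0.

(* Existence of an invariant probability [lambda] (for the kernel with density
   [f1]) and convergence in total variation to it from every starting point;
   [Px x] is the law of the chain started at [x]. *)
Definition positive_ergodic (d' d : measure_display) (Om : measurableType d')
    (T : measurableType d) (R : realType) (mu : {measure set T -> \bar R})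
    (Px : T -> probability Om R) (X : nat -> {mfun Om >-> T})
    (f1 : T -> T -> R) (lambda : probability T R) : Prop :=
  (forall B, measurable B ->
    (lambda B = \int[lambda]_x \int[mu]_(y in B) (f1 y x)%:E)%E) /\
  (forall x,
    (fun n => ereal_sup [set `|Px x (X n @^-1` B) - lambda B|%E
                        | B in measurable]) @ \oo --> 0%E).

(* Real-valued when [f0] and [f1] have the same zeros; where both vanish the
   log-ratio is undefined and the convention 0 / 0 = 0, ln 0 = 0 gives 0. *)
Definition llr (T : Type) (R : realType) (f0 f1 : T -> T -> R) (y x : T) : R :=
  ln (f1 y x / f0 y x).

(* Z^k_n *)
Definition Zsum (Om T : Type) (R : realType) (g : T -> T -> R)
    (X : nat -> Om -> T) (k n : nat) (w : Om) : R :=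
  \sum_(k.+1 <= j < n.+1) g (X j w) (X j.-1 w).

Definition gtilde (d : measure_display) (T : measurableType d) (R : realType)
    (mu : {measure set T -> \bar R}) (g f1 : T -> T -> R) (x : T) : R :=
  \int[mu]_y (g y x * f1 y x).

Definition gstar (d' d : measure_display) (Om : measurableType d')
    (T : measurableType d) (R : realType) (Px : T -> probability Om R)
    (X : nat -> {mfun Om >-> T}) (g : T -> T -> R) (r : R) (x : T) : \bar R :=
  ereal_sup [set ('E_(Px x)[fun w => (`|g (X n w) (X n.-1 w)| `^ r)%R])%E
            | n in [set n | (1 <= n)%N]].

Definition upsilonstar (d' d : measure_display) (Om : measurableType d')
    (T : measurableType d) (R : realType) (Px : T -> probability Om R)
    (X : nat -> {mfun Om >-> T}) (V : T -> R) (r : R) (x : T) : \bar R :=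
  ereal_sup [set ('E_(Px x)[fun w => (V (X n w) `^ r)%R])%E | n in [set: nat]].

(* Main.v *)
Require Import Defs.
From HB Require Import structures.
From mathcomp Require Import all_boot all_order all_algebra.
From mathcomp Require Import all_classical all_reals all_analysis.
From mathcomp Require Import measurable_realfun.
From mathcomp Require Import ring lra.
Import Order.TTheory GRing.Theory Num.Theory.
Import numFieldNormedType.Exports.

(** The normalized log-likelihood ratio over the [n] observations that follow
    the change point differs from [I] by the average of [n] centred increments
    of a chain with transition density [f1]. The proof bounds the probability
    that this average exceeds [eps].

    The small set [C] and the drift condition enter through regeneration. From a
    point of [C] the chain restarts with the subprobability density [m * \1_C],
    so the transition operator is the sum of a residual operator [Q], which
    loses mass on [C] only, and of a rank-one operator. An affine function [W] of
    [V] satisfies [V + Q W <= W] ([potential_decrease]); hence [a = h + Q a] is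
    solvable with [0 <= a <= W] as soon as [0 <= h <= V] ([resolvent]), and
    combining the solutions for [gtilde] and for 1 gives a function [u] with
    [|u| <= K V] that solves the Poisson equation for [gtilde - I]
    ([poisson_solution]). Here [gtilde >= 0], being a Kullback--Leibler
    divergence.

    With [u] the centred sum becomes a martingale up to two boundary terms. An
    elementary inequality for [|a + b| ^ r] ([normD_powR_le]) bounds its moment
    of order [r] after [n] steps by a multiple of [n ^ (r / 2)], as long as the
    moments of the increments and of [V] are bounded along the chain. Markov's
    inequality then gives a probability of order [n ^ (- r / 2)] ([tail_le]),
    which is summable because [r > 2]. For a change point [k >= 1] the law of
    [X k] is the law without change, for which the moments are bounded uniformly
    in [k].

    For [k = 0] only [V] is known to be integrable at the initial time. This
    single law needs no uniform rate: it suffices that the expected number of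
    indices [n] with [|sum| > eps n] is finite. Before the first regeneration
    this number is controlled by the elapsed time and by the size of the sum,
    both integrable by the drift condition, and after it by the moment bound for
    the regeneration measure ([tails_le]). The moments for that measure are
    bounded because the chain that moves with density [f1] from the law of [X 1]
    without change visits [C] with positive probability and regenerates there
    ([regen_moment]).

    Expectations are computed by iterating operators that act on functions of
    the last observation and of the running sum ([sum_trans]); [process_state]
    identifies these iterates with expectations under the given laws. *)

Set Implicit Arguments.
Unset Strict Implicit.
Unset Printing Implicit Defensive.

Local Open Scope classical_set_scope.
Local Open Scope ring_scope.

(** * Real inequalities *)

Section real_inequalities.
Context (R : realType).
Implicit Types (a b r s t x y N : R).

Lemma one_powR x : 1 `^ x = 1 :> R.
Proof. by rewrite powR1. Qed.

Lemma expR_le_quadratic x : x <= 2^-1 -> expR x <= 1 + x + 2 * x ^+ 2.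
Proof.
move=> x2; have h : 1 - x <= expR (- x) by apply: expR_ge1Dx.
have x1 : 0 < 1 - x by lra.
have -> : expR x = (expR (- x))^-1 by rewrite expRN invrK.
apply: (@le_trans _ _ (1 - x)^-1); first by rewrite lef_pV2 ?posrE ?expR_gt0.
rewrite -[leLHS]mul1r ler_pdivrMr//.
have -> : (1 + x + 2 * x ^+ 2) * (1 - x) = 1 + x ^+ 2 * (1 - 2 * x) by ring.
by rewrite lerDl mulr_ge0 ?sqr_ge0//; lra.
Qed.

(** For small [r * t] the left side is at most [expR (r * t)]; otherwise the
    last term alone suffices. *)
Lemma norm1D_powR_le r t : 2 < r ->
  `|1 + t| `^ r <= 1 + r * t + 2 * (r * t) ^+ 2 + (1 + 2 * r) `^ r * `|t| `^ r.
Proof.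
move=> r2; have r0 : 0 < r by lra.
have [ht|ht] := lerP `|r * t| 2^-1.
  have [h1 h2] : - 2^-1 <= r * t /\ r * t <= 2^-1.
    by move: ht; rewrite ler_norml => /andP[].
  have t1 : 0 < 1 + t.
    suff : - 1 < t by lra.
    rewrite -(ltr_pM2l r0); lra.
  apply: (@le_trans _ _ (expR (r * t))); last first.
    apply: le_trans (expR_le_quadratic h2) _.
    by rewrite lerDl mulr_ge0 ?powR_ge0.
  rewrite gtr0_norm// /powR gt_eqF// ler_expR ler_pM2l//.
  by apply: le_ln1Dx; lra.
have tq : 1 <= 2 * r * `|t| by move: ht; rewrite normrM gtr0_norm//; lra.
apply: (@le_trans _ _ ((1 + 2 * r) `^ r * `|t| `^ r)); last first.
  rewrite lerDr; have -> : 1 + r * t + 2 * (r * t) ^+ 2 =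
    2 * (r * t + 4^-1) ^+ 2 + 7 / 8 by field.
  by apply: addr_ge0; [rewrite mulr_ge0 ?sqr_ge0|lra].
rewrite -powRM//; last lra.
apply: ge0_ler_powR; rewrite ?nnegrE ?mulr_ge0//; try lra.
by rewrite (le_trans (ler_normD _ _))// normr1 mulrDl mul1r; lra.
Qed.

(** The two terms take care of [N * t ^+ 2] at most 1 and above 1. *)
Lemma sqr_le_split r t N : 2 < r -> 1 <= N ->
  t ^+ 2 <= N^-1 + N `^ (r / 2 - 1) * `|t| `^ r.
Proof.
move=> r2 N1; have N0 : 0 < N by lra.
have p0 : 0 <= r / 2 - 1 by lra.
have [h|h] := lerP (N * t ^+ 2) 1.
  apply: (@le_trans _ _ N^-1); last by rewrite lerDl mulr_ge0 ?powR_ge0.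
  by rewrite -[N^-1]mul1r ler_pdivlMr// mulrC.
have t0 : t != 0 by apply: contraTneq h => ->; rewrite expr0n/= mulr0; lra.
apply: (@le_trans _ _ (N `^ (r / 2 - 1) * `|t| `^ r)); last first.
  by rewrite lerDr invr_ge0 ltW.
have -> : `|t| `^ r = (t ^+ 2) `^ (r / 2 - 1) * t ^+ 2.
  rewrite mulrC mulr_powRB1 ?sqr_ge0//; last lra.
  rewrite -[t ^+ 2]real_normK ?num_real// -powR_mulrn// -powRrM.
  by congr (_ `^ _); field.
rewrite mulrA -powRM ?sqr_ge0//; last lra.
rewrite -[leLHS]mul1r ler_wpM2r ?sqr_ge0//.
rewrite -[leLHS](one_powR (r / 2 - 1)); apply: ge0_ler_powR => //.
- by rewrite nnegrE.
- by rewrite nnegrE mulr_ge0 ?sqr_ge0// ltW.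
- exact: ltW.
Qed.

(** The linear term in [b] vanishes after integration against a centred
    increment; the weight [N^-1] of the first term is what lets this inequality
    be iterated [N] times with a bounded factor. *)
Lemma normD_powR_le r a b N c : 2 < r -> 1 <= N ->
  c = 2 * r ^+ 2 + (1 + 2 * r) `^ r ->
  `|a + b| `^ r <= (1 + c / N) * `|a| `^ r + r * `|a| `^ r / a * b
                   + c * N `^ (r / 2 - 1) * `|b| `^ r.
Proof.
move=> r2 N1 cE; have r0 : 0 < r by lra.
have p0 : 0 <= r / 2 - 1 by lra.
have N0 : 0 < N by lra.
have NN : 1 <= N `^ (r / 2 - 1).
  by rewrite -[leLHS](powRr0 N) ler_powR.
have c1 : 2 * r ^+ 2 <= c by rewrite cE lerDl powR_ge0.
have c2 : (1 + 2 * r) `^ r <= c by rewrite cE lerDr mulr_ge0 ?sqr_ge0.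
have c0 : 0 <= c by apply: le_trans c2; exact: powR_ge0.
have [->|a0] := eqVneq a 0.
  have rn0 : r != 0 by rewrite gt_eqF.
  rewrite add0r normr0 powR0// !(mulr0, mul0r, add0r) ler_peMl ?powR_ge0//.
  rewrite -[leLHS]mul1r ler_pM//.
  apply: le_trans c2; rewrite -[leLHS](one_powR r) ge0_ler_powR ?nnegrE//; lra.
pose t := b / a; have bE : b = a * t by rewrite /t mulrC divfK.
have -> : a + b = a * (1 + t) by rewrite bE mulrDr mulr1.
have -> : r * `|a| `^ r / a * b = `|a| `^ r * (r * t).
  by rewrite /t; field.
have -> : `|b| `^ r = `|a| `^ r * `|t| `^ r by rewrite bE normrM powRM.
rewrite normrM powRM//.
set A := `|a| `^ r; set B := `|t| `^ r.
have A0 : 0 <= A by exact: powR_ge0.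
have B0 : 0 <= B by exact: powR_ge0.
apply: (@le_trans _ _ (A * (1 + r * t + 2 * (r * t) ^+ 2 + (1 + 2 * r) `^ r * B))).
  by apply: ler_wpM2l => //; exact: norm1D_powR_le.
have -> : (1 + c / N) * A + A * (r * t) + c * N `^ (r / 2 - 1) * (A * B) =
  A * (1 + r * t + c * N^-1 + c * N `^ (r / 2 - 1) * B) by ring.
apply: ler_wpM2l => //.
rewrite -!addrA !lerD2l.
have := sqr_le_split t r2 N1; rewrite -/B => ht.
apply: (@le_trans _ _ (2 * r ^+ 2 * (N^-1 + N `^ (r / 2 - 1) * B) +
   (1 + 2 * r) `^ r * (N `^ (r / 2 - 1) * B))).
  apply: lerD.
    by rewrite exprMn mulrA ler_wpM2l// mulr_ge0 ?sqr_ge0.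
  by rewrite ler_wpM2l ?powR_ge0// ler_peMl.
rewrite cE -subr_ge0; set k := (1 + 2 * r) `^ r.
have -> : forall q w, (q + k) / N + (q + k) * w * B -
    (q * (N^-1 + w * B) + k * (w * B)) = k / N by move=> *; ring.
by rewrite mulr_ge0 ?powR_ge0 ?invr_ge0// ltW.
Qed.

Lemma normD_powR_le2 r x y : 0 <= r ->
  `|x + y| `^ r <= 2 `^ r * (`|x| `^ r + `|y| `^ r).
Proof.
move=> r0; wlog xy : x y / `|x| <= `|y|.
  move=> h; have [|/ltW] := lerP `|x| `|y|; first exact: h.
  by rewrite addrC [X in _ <= _ * X]addrC; exact: h.
apply: (@le_trans _ _ ((2 * `|y|) `^ r)).
  rewrite ge0_ler_powR// ?nnegrE ?mulr_ge0//.
  by rewrite (le_trans (ler_normD _ _))//; lra.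
by rewrite powRM// ler_wpM2l ?powR_ge0// lerDr powR_ge0.
Qed.

(** Instead of the mean value theorem: [expR] above its tangent at 0, and
    [ln (x / (x + 1)) <= - (x + 1)^-1]. *)
Lemma powRN_diff_ge a x : 0 < a -> 0 < x ->
  a * (x + 1) `^ (- (a + 1)) <= x `^ (- a) - (x + 1) `^ (- a).
Proof.
move=> a0 x0; have x1 : 0 < x + 1 by lra.
have yE : 1 + (x / (x + 1) - 1) = x / (x + 1) by lra.
have xx : 0 < x / (x + 1) by rewrite divr_gt0.
have hln : ln (x / (x + 1)) <= - (x + 1)^-1.
  rewrite -yE; apply: le_trans (le_ln1Dx _) _; first by lra.
  by rewrite le_eqVlt; apply/orP; left; apply/eqP; field; lra.
have -> : x `^ (- a) = (x + 1) `^ (- a) * (x / (x + 1)) `^ (- a).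
  by rewrite -powRM ?ltW//; congr (_ `^ _); field; lra.
have -> : (x + 1) `^ (- (a + 1)) = (x + 1) `^ (- a) * (x + 1)^-1.
  by rewrite opprD powRD ?powR_inv1 ?ltW//; rewrite (gt_eqF x1) implybT.
rewrite mulrCA -[X in _ <= _ - X]mulr1 -mulrBr ler_wpM2l ?powR_ge0//.
rewrite lerBrDr addrC /powR (gt_eqF xx).
apply: le_trans (expR_ge1Dx _); rewrite lerD2l mulNr -mulrN ler_pM2l//.
by rewrite lerNr.
Qed.

(** Comparison with the telescoping differences of [n `^ (1 - s)]. *)
Lemma sum_powRN_le s n : 1 < s ->
  \sum_(1 <= i < n.+2) i%:R `^ (- s) <=
  1 + (s - 1)^-1 - (s - 1)^-1 * n.+1%:R `^ (- (s - 1)) :> R.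
Proof.
move=> s1; have s0 : 0 < s - 1 by lra.
elim: n => [|n IH].
  by rewrite big_nat1 !powR1 mulr1 addrK.
rewrite big_nat_recr//=; apply: (@le_trans _ _ (1 + (s - 1)^-1 -
  (s - 1)^-1 * n.+1%:R `^ (- (s - 1)) + n.+2%:R `^ (- s))); first by rewrite lerD2r.
have := powRN_diff_ge s0 (ltr0Sn R n).
rewrite natr1 subrK -ler_pdivlMl// mulrBr.
by lra.
Qed.

Lemma sum_powRN_bound s n : 1 < s ->
  \sum_(0 <= l < n) l.+1%:R `^ (- s) <= 1 + (s - 1)^-1 :> R.
Proof.
move=> s1; have s0 : 0 < s - 1 by lra.
case: n => [|n]; first by rewrite big_nil addr_ge0// invr_ge0 ltW.
have := sum_powRN_le n s1; rewrite big_add1/= => h; apply: (le_trans h).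
by rewrite lerBlDr lerDl mulr_ge0 ?powR_ge0// invr_ge0 ltW.
Qed.

Lemma powRN_decreasing s x y : 0 <= s -> 0 < x -> x <= y -> y `^ (- s) <= x `^ (- s).
Proof.
move=> s0 x0 xy; have y0 : 0 < y by apply: lt_le_trans xy.
rewrite !powRN lef_pV2 ?posrE ?powR_gt0//.
by apply: ge0_ler_powR; rewrite ?nnegrE// ltW.
Qed.

End real_inequalities.

Local Open Scope ereal_scope.

(** * Nonnegative measurable functions *)

Definition nnmf (d : measure_display) (T : measurableType d) (R : realType)
    (F : T -> \bar R) : Prop :=
  measurable_fun setT F /\ forall x, 0 <= F x.

Section nnmf_lemmas.
Context (d : measure_display) (T : measurableType d) (R : realType).
Implicit Types F G : T -> \bar R.
Import HBNNSimple.

Lemma nnmfD F G : nnmf F -> nnmf G -> nnmf (fun x => F x + G x).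
Proof.
move=> [mF F0] [mG G0]; split; first exact: emeasurable_funD.
by move=> x; rewrite adde_ge0.
Qed.

Lemma nnmfM F G : nnmf F -> nnmf G -> nnmf (fun x => F x * G x).
Proof.
move=> [mF F0] [mG G0]; split; first exact: emeasurable_funM.
by move=> x; rewrite mule_ge0.
Qed.

Lemma nnmf_cst (c : \bar R) : 0 <= c -> nnmf (fun _ : T => c).
Proof. by move=> c0; split=> //; exact: measurable_cst. Qed.

Lemma nnmfZ (c : R) F : (0 <= c)%R -> nnmf F -> nnmf (fun x => c%:E * F x).
Proof. by move=> c0; apply: nnmfM; apply: nnmf_cst; rewrite lee_fin. Qed.

Lemma nnmf_sum (I : Type) (s : seq I) (F : I -> T -> \bar R) :
  (forall i, nnmf (F i)) -> nnmf (fun x => \sum_(i <- s) F i x).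
Proof.
move=> nF; split; first by apply: emeasurable_sum => i; case: (nF i).
by move=> x; apply: sume_ge0 => i _; case: (nF i).
Qed.

Lemma nnmf_EFin (h : T -> R) :
  measurable_fun setT h -> (forall x, (0 <= h x)%R) -> nnmf (EFin \o h).
Proof.
by move=> mh h0; split; [exact/measurable_EFinP|move=> x; rewrite lee_fin].
Qed.

Lemma nnmf_indic (A : set T) :
  measurable A -> nnmf (fun x => (\1_A x)%:E : \bar R).
Proof.
move=> mA; apply: nnmf_EFin; first exact: measurable_indic.
by move=> x; rewrite indicE.
Qed.

Lemma nnmf_comp d' (T' : measurableType d') (th : T' -> T) F :
  measurable_fun setT th -> nnmf F -> nnmf (F \o th).
Proof.
by move=> mth [mF F0]; split; [exact: measurableT_comp|move=> x; exact: F0].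
Qed.

Lemma nnmf_lim (F : (T -> \bar R)^nat) :
  (forall n, nnmf (F n)) -> (forall x, nondecreasing_seq (F ^~ x)) ->
  nnmf (fun x => limn (F ^~ x)).
Proof.
move=> nF ndF; split.
  apply: (emeasurable_fun_cvg F) => [n|x _]; first by case: (nF n).
  exact: ereal_nondecreasing_is_cvgn.
move=> x; apply: lime_ge; first exact: ereal_nondecreasing_is_cvgn.
by apply: nearW => n; case: (nF n).
Qed.

(** A nonnegative measurable function is the limit of an increasing sequence of
    simple functions, and these are sums of multiples of indicators. *)
Lemma nnmf_ind (Pr : (T -> \bar R) -> Prop) :
  (forall A, measurable A -> Pr (fun x => (\1_A x)%:E)) ->
  (forall c F, (0 <= c)%R -> nnmf F -> Pr F -> Pr (fun x => c%:E * F x)) ->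
  (forall F G, nnmf F -> nnmf G -> Pr F -> Pr G -> Pr (fun x => F x + G x)) ->
  (forall F : (T -> \bar R)^nat, (forall n, nnmf (F n)) ->
     (forall x, nondecreasing_seq (F ^~ x)) -> (forall n, Pr (F n)) ->
     Pr (fun x => limn (F ^~ x))) ->
  forall F, nnmf F -> Pr F.
Proof.
move=> P1 PZ PD Plim F [mF F0].
pose g := nnsfun_approx measurableT mF.
have -> : F = fun x => limn (fun n => (g n x)%:E).
  apply/funext => x; apply/esym/cvg_lim => //.
  exact: (cvg_nnsfun_approx measurableT mF (fun x _ => F0 x)).
apply: (Plim (fun n x => (g n x)%:E)).
- move=> n; apply: nnmf_EFin; [exact: measurable_funP|exact: fun_ge0].
- by move=> x m n mn; rewrite lee_fin; exact/lefP/nd_nnsfun_approx.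
move=> n; have P0 : Pr (fun=> 0).
  rewrite [X in Pr X](_ : _ = fun x => (\1_(@set0 T) x)%:E); first exact: P1.
  by apply/funext => x; rewrite indic0.
(* the coefficients [Num.max y 0] are nonnegative for all [y], not only for the
   values of [g n] *)
rewrite [X in Pr X](_ : _ = fun x =>
    \sum_(y <- finmap.enum_fset (fset_set (range (g n))))
      (Num.max y 0)%R%:E * (\1_(g n @^-1` [set y]) x)%:E).
  elim: (finmap.enum_fset _) =>  [|y s ih].
    by rewrite [X in Pr X](_ : _ = fun=> 0) //; apply/funext => x;
       rewrite big_nil.
  rewrite [X in Pr X](_ : _ = fun x =>
    (Num.max y 0)%R%:E * (\1_(g n @^-1` [set y]) x)%:E +
    \sum_(j <- s) (Num.max j 0)%R%:E * (\1_(g n @^-1` [set j]) x)%:E); last first.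
    by apply/funext => x; rewrite big_cons.
  have mg z : measurable (g n @^-1` [set z]) by exact: measurable_funPTI.
  have m0 z : (0 <= Num.max z 0 :> R)%R by rewrite le_max lexx orbT.
  apply: PD => //.
  - by apply: nnmfZ => //; exact: nnmf_indic.
  - by apply: nnmf_sum => j; apply: nnmfZ => //; exact: nnmf_indic.
  - by apply: PZ => //; [exact: nnmf_indic|exact: P1].
apply/funext => x; rewrite fimfunE fsbig_finite//= sumEFin.
congr EFin; rewrite big_seq [RHS]big_seq; apply: eq_bigr => y.
rewrite in_fset_set//= inE => -[z _ <-]; rewrite max_l//; exact: fun_ge0.
Qed.

Context (mu : {measure set T -> \bar R}).

Lemma nn_integralD F G : nnmf F -> nnmf G ->
  \int[mu]_x (F x + G x) = \int[mu]_x F x + \int[mu]_x G x.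
Proof. by move=> [mF F0] [mG G0]; exact: ge0_integralD. Qed.

Lemma nn_integralZ (c : R) F : (0 <= c)%R -> nnmf F ->
  \int[mu]_x (c%:E * F x) = c%:E * \int[mu]_x F x.
Proof. by move=> c0 [mF F0]; exact: ge0_integralZl_EFin. Qed.

Lemma nn_integral_ge0 F : nnmf F -> 0 <= \int[mu]_x F x.
Proof. by move=> [mF F0]; exact: integral_ge0. Qed.

Lemma nn_le_integral F G : nnmf F -> nnmf G -> (forall x, F x <= G x) ->
  \int[mu]_x F x <= \int[mu]_x G x.
Proof. by move=> [mF F0] [mG G0] FG; exact: ge0_le_integral. Qed.

Lemma nn_integral_lim (F : (T -> \bar R)^nat) :
  (forall n, nnmf (F n)) -> (forall x, nondecreasing_seq (F ^~ x)) ->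
  \int[mu]_x limn (F ^~ x) = limn (fun n => \int[mu]_x F n x).
Proof.
move=> nF ndF; apply: monotone_convergence => //.
- by move=> n; case: (nF n).
- by move=> n x _; case: (nF n).
Qed.

Lemma nn_integral_sum (I : Type) (s : seq I) (F : I -> T -> \bar R) :
  (forall i, nnmf (F i)) ->
  \int[mu]_x (\sum_(i <- s) F i x) = \sum_(i <- s) \int[mu]_x F i x.
Proof.
move=> nF; apply: ge0_integral_sum => //.
- by move=> i; case: (nF i).
- by move=> i x _; case: (nF i).
Qed.

End nnmf_lemmas.

(** In the applications [m] is the law of a pair of observations, or an
    invariant law, and [K] is a transition density. *)
Lemma integral_density_ext d0 d1 d2 (Z' : measurableType d0)
    (Z : measurableType d1) (Y : measurableType d2) (R : realType)
    (m : {measure set Z' -> \bar R}) (nu : {measure set Y -> \bar R})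
    (G' : Z' -> Z) (K : Y -> R) (G : Y -> Z) :
  measurable_fun setT G' ->
  measurable_fun setT K -> (forall y, (0 <= K y)%R) -> measurable_fun setT G ->
  (forall A, measurable A ->
    m (G' @^-1` A) = \int[nu]_y ((K y)%:E * (\1_A (G y))%:E)) ->
  forall F, nnmf F -> \int[m]_z F (G' z) = \int[nu]_y ((K y)%:E * F (G y)).
Proof.
move=> mG' mK K0 mG mA.
have nK : nnmf (EFin \o K) by exact: nnmf_EFin.
have nc F : nnmf F -> nnmf (fun y => (K y)%:E * F (G y)).
  by move=> nF; apply: nnmfM => //; exact: (nnmf_comp mG nF).
have nc' (F : Z -> \bar R) : nnmf F -> nnmf (F \o G') by exact: nnmf_comp.
apply: nnmf_ind.
- move=> A mesA; rewrite -mA//.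
  rewrite -[X in _ = m X]setIT -integral_indic//.
  by rewrite -[X in measurable X]setTI; exact: mG'.
- move=> c F c0 nF IH; rewrite (nn_integralZ _ c0 (nc' _ nF)) IH.
  rewrite -nn_integralZ//; last exact: nc.
  by apply: eq_integral => y _; rewrite muleCA.
- move=> F F' nF nF' IH IH'.
  rewrite (nn_integralD _ (nc' _ nF) (nc' _ nF')) IH IH'.
  rewrite -nn_integralD//; [|exact: nc|exact: nc].
  by apply: eq_integral => y _; rewrite ge0_muleDr//; [case: nF|case: nF'].
- move=> F nF ndF IH.
  rewrite (nn_integral_lim _ (fun n => nc' _ (nF n)) (fun x => ndF (G' x))).
  under eq_fun do rewrite IH.
  rewrite -nn_integral_lim//; last 2 first.
  + by move=> n; exact: nc.
  + by move=> y a b ab; apply: lee_wpmul2l; [rewrite lee_fin|exact: ndF].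
  apply: eq_integral => y _; apply: limeMl => //.
  exact: ereal_nondecreasing_is_cvgn.
Qed.

(** * One step of the process *)

Section markov_step.
Context (d' d : measure_display) (Om : measurableType d')
  (T : measurableType d) (R : realType)
  (mu : {sigma_finite_measure set T -> \bar R})
  (P : probability Om R) (X : nat -> {mfun Om >-> T})
  (init : set T -> \bar R) (p : nat -> T -> T -> R)
  (tp : forall n, transition_density mu (p n))
  (PX : markov_law mu P X init p).

Lemma history_measurable n : history X n `<=` measurable.
Proof.
apply: smallest_sub; first exact: sigma_algebra_measurable.
move=> _ [i _ [B mB <-]].
have mX : measurable_fun setT (X i) by [].
exact: mX.
Qed.

(** The Markov property concerns the events [F `&` X n.+1 @^-1` B], that is,
    rectangles for the pair of the history and the next observation. Rectangles
    are stable under intersection and generate the product sigma-algebra, so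
    they determine the joint law. *)
Lemma markov_step n dU (U : measurableType dU) (H : Om -> U)
    (Phi : U * T -> \bar R) :
  (forall A, measurable A -> history X n (H @^-1` A)) -> nnmf Phi ->
  \int[P]_w Phi (H w, X n.+1 w) =
  \int[P]_w \int[mu]_y ((p n.+1 y (X n w))%:E * Phi (H w, y)).
Proof.
move=> HH nPhi.
have mH : measurable_fun setT H.
  by move=> _ A mA; rewrite setTI; apply: (@history_measurable n); exact: HH.
have [mp p0 p1] := tp n.+1.
pose K (z : Om * T) := p n.+1 z.2 (X n z.1).
pose G (z : Om * T) := (H z.1, z.2).
have mX m : measurable_fun setT (fun z : Om * T => X m z.1).
  by apply: measurableT_comp => //; exact: measurable_fst.
have mK : measurable_fun setT K.
  apply: (measurableT_comp mp (g := fun z : Om * T => (z.2, X n z.1))).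
  by apply: measurable_fun_pair => //; exact: measurable_snd.
have K0 z : (0 <= K z)%R by exact: p0.
have mG : measurable_fun setT G.
  apply: measurable_fun_pair; last exact: measurable_snd.
  by apply: measurableT_comp => //; exact: measurable_fst.
have mG' : measurable_fun setT (fun w => (H w, X n.+1 w)).
  exact: measurable_fun_pair.
have nKG F : nnmf F -> nnmf (fun z : Om * T => (K z)%:E * F (G z)).
  by move=> nF; apply: nnmfM; [exact: nnmf_EFin|exact: (nnmf_comp mG nF)].
have fub F : nnmf F -> \int[P \x mu]_z ((K z)%:E * F (G z)) =
    \int[P]_w \int[mu]_y ((p n.+1 y (X n w))%:E * F (H w, y)).
  by move=> nF; rewrite fubini_tonelli1//; case: (nKG F nF).
rewrite -fub//; apply: (integral_density_ext mG' mK K0 mG _ nPhi) => A mA.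
have nA B : measurable B -> nnmf (fun u : U * T => (\1_B u)%:E : \bar R).
  exact: nnmf_indic.
have mG1 B : measurable B -> measurable ((fun w => (H w, X n.+1 w)) @^-1` B).
  by move=> mB; rewrite -[X in measurable X]setTI; exact: mG'.
have KT : \int[P \x mu]_z ((K z)%:E * (\1_[set: U * T] (G z))%:E) = 1.
  rewrite (fub (fun u => (\1_setT u)%:E)); last exact: nA.
  under eq_integral => w _.
    under eq_integral do rewrite indicT mule1.
    rewrite p1; over.
  rewrite integral_cst// mul1e; exact: probability_setT.
pose Pr (A : set (U * T)) := P ((fun w => (H w, X n.+1 w)) @^-1` A) =
  \int[P \x mu]_z ((K z)%:E * (\1_A (G z))%:E).
have fubA B : measurable B -> \int[P \x mu]_z ((K z)%:E * (\1_B (G z))%:E) =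
    \int[P]_w \int[mu]_y ((p n.+1 y (X n w))%:E * (\1_B (H w, y))%:E).
  by move=> mB; rewrite (fub (fun u => (\1_B u)%:E))//; exact: nA.
have nKA B : measurable B -> nnmf (fun z : Om * T => (K z)%:E * (\1_B (G z))%:E).
  by move=> mB; apply: (nKG (fun u => (\1_B u)%:E)); exact: nA.
have KA_fin B : measurable B ->
    \int[P \x mu]_z ((K z)%:E * (\1_B (G z))%:E) \is a fin_num.
  move=> mB; rewrite ge0_fin_numE; last exact: nn_integral_ge0 (nKA _ mB).
  apply: (@le_lt_trans _ _ 1); last exact: ltry.
  rewrite -KT; apply: nn_le_integral; [exact: nKA|exact: nKA|move=> z].
  apply: lee_wpmul2l; rewrite lee_fin// indicT.
  by rewrite indicE; case: (_ \in _).
rewrite -/(Pr A); move: A mA; rewrite measurable_prod_measurableType.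
apply: (dynkin_induction (G := [set A `*` B | A in measurable & B in measurable])
  (P := Pr)).
- exact: measurable_prod_measurableType.
- move=> _ _ [A1 mA1 [B1 mB1 <-]] [A2 mA2 [B2 mB2 <-]].
  exists (A1 `&` A2); first exact: measurableI.
  by exists (B1 `&` B2); [exact: measurableI|rewrite setXI].
- by rewrite /Pr KT preimage_setT; exact: probability_setT.
- move=> _ [A mA [B mB <-]].
  rewrite /Pr.
  have -> : (fun w => (H w, X n.+1 w)) @^-1` (A `*` B) =
      (H @^-1` A) `&` (X n.+1 @^-1` B) by [].
  rewrite (PX.2 _ _ _ (HH _ mA) mB) fubA; last exact: measurableX.
  rewrite integral_mkcond; apply: eq_integral => w _; rewrite patchE.
  case: ifPn => wA.
    rewrite integral_mkcond; apply: eq_integral => y _; rewrite patchE.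
    rewrite indicE in_setX /= -[H w \in A]/(w \in H @^-1` A) wA /=.
    by case: (y \in B); rewrite (mule1, mule0).
  rewrite integral0_eq// => y _.
  rewrite indicE in_setX /= -[H w \in A]/(w \in H @^-1` A) (negbTE wA).
  by rewrite mule0.
- move=> A mA IH.
  rewrite /Pr preimage_setC probability_setC; last exact: mG1.
  have mCA : measurable (~` A) by exact: measurableC.
  have {1}<- : \int[P \x mu]_z ((K z)%:E * (\1_A (G z))%:E) +
      \int[P \x mu]_z ((K z)%:E * (\1_(~` A) (G z))%:E) = 1.
    rewrite -KT -nn_integralD; [|exact: nKA|exact: nKA].
    apply: eq_integral => z _; rewrite -ge0_muleDr ?lee_fin//.
    congr (_ * _); rewrite -EFinD !indicE in_setT in_setC.
    by case: (_ \in A); rewrite ?addr0 ?add0r.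
  by rewrite IH [X in X - _]addeC addeK//; exact: KA_fin.
- move=> F mF tF IH.
  rewrite /Pr preimage_bigcup measure_bigcup//; last 2 first.
  + by move=> i _; exact: mG1.
  + move=> i j _ _ [w [/= Fi Fj]]; apply: tF => //.
    by exists (H w, X n.+1 w).
  rewrite (eq_eseriesl (Q := xpredT)); last by move=> i; rewrite in_setT.
  rewrite (eq_eseriesr (g := fun i =>
    \int[P \x mu]_z ((K z)%:E * (\1_(F i) (G z))%:E))); last by move=> i _; exact: IH.
  rewrite -integral_nneseries//; last 2 first.
  + by move=> i; case: (nKA _ (mF i)).
  + by move=> i z _; case: (nKA _ (mF i)).
  apply: eq_integral => z _; rewrite indic_bigcup//.
  by rewrite nneseriesZl// => i _; rewrite lee_fin indicE.
Qed.
End markov_step.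

(** * Density operators *)

Definition kernel_density (dS d : measure_display) (S : measurableType dS)
    (T : measurableType d) (R : realType) (k : T -> S -> R) : Prop :=
  measurable_fun setT (fun z : S * T => k z.2 z.1) /\
  forall y s, (0 <= k y s)%R.

(** A chain that moves from the state [s] to the state [th (s, y)], where [y] is
    drawn with density [k y s], sends the function [F] to its conditional
    expectation one step ahead. Taking [th = snd] gives the transition operator
    of the observed chain; a larger state also records a running sum. *)
Definition kop (dS d : measure_display) (S : measurableType dS)
    (T : measurableType d) (S' : Type) (R : realType)
    (mu : {measure set T -> \bar R}) (k : T -> S -> R) (th : S * T -> S')
    (F : S' -> \bar R) (s : S) : \bar R :=
  \int[mu]_y ((k y s)%:E * F (th (s, y))).

Section kop_lemmas.
Context (dS d dS' : measure_display) (S : measurableType dS)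
  (T : measurableType d) (S' : measurableType dS') (R : realType)
  (mu : {sigma_finite_measure set T -> \bar R}) (k : T -> S -> R)
  (th : S * T -> S') (dk : kernel_density k) (mth : measurable_fun setT th).
Implicit Types F G : S' -> \bar R.

Let nnmf_joint F : nnmf F -> nnmf (fun z : S * T => (k z.2 z.1)%:E * F (th z)).
Proof.
move=> nF; apply: nnmfM; last exact: (nnmf_comp mth nF).
by apply: nnmf_EFin; [exact: dk.1|move=> z; exact: dk.2].
Qed.

Lemma nnmf_kop_integrand F s : nnmf F -> nnmf (fun y => (k y s)%:E * F (th (s, y))).
Proof.
move=> /nnmf_joint nF; apply: (nnmf_comp _ nF (th := fun y => (s, y))).
by apply: measurable_fun_pair => //; exact: measurable_cst.
Qed.

Lemma nnmf_kop F : nnmf F -> nnmf (kop mu k th F).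
Proof.
move=> /nnmf_joint [mF F0]; split.
  exact: (measurable_fun_fubini_tonelli_F (m2 := mu) _ mF).
by move=> s; apply: integral_ge0 => y _; exact: (F0 (s, y)).
Qed.

Lemma kop_le F G s : nnmf F -> nnmf G -> (forall x, F x <= G x) ->
  kop mu k th F s <= kop mu k th G s.
Proof.
move=> nF nG FG; apply: nn_le_integral; [exact: nnmf_kop_integrand..|move=> y].
by apply: lee_wpmul2l => //; rewrite lee_fin; exact: dk.2.
Qed.

Lemma kopD F G s : nnmf F -> nnmf G ->
  kop mu k th (fun x => F x + G x) s = kop mu k th F s + kop mu k th G s.
Proof.
move=> nF nG; rewrite /kop -nn_integralD; [|exact: nnmf_kop_integrand..].
by apply: eq_integral => y _; rewrite ge0_muleDr//; [case: nF|case: nG].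
Qed.

Lemma kopZ (c : R) F s : (0 <= c)%R -> nnmf F ->
  kop mu k th (fun x => c%:E * F x) s = c%:E * kop mu k th F s.
Proof.
move=> c0 nF; rewrite /kop -nn_integralZ//; last exact: nnmf_kop_integrand.
by apply: eq_integral => y _; rewrite muleCA.
Qed.

Lemma kop_sum (I : Type) (r : seq I) (F : I -> S' -> \bar R) s :
  (forall i, nnmf (F i)) ->
  kop mu k th (fun x => \sum_(i <- r) F i x) s =
  \sum_(i <- r) kop mu k th (F i) s.
Proof.
move=> nF; rewrite /kop -nn_integral_sum; last first.
  by move=> i; exact: nnmf_kop_integrand.
by apply: eq_integral => y _; rewrite ge0_sume_distrr// => i _; case: (nF i).
Qed.

Lemma kop_lim (F : (S' -> \bar R)^nat) s :
  (forall n, nnmf (F n)) -> (forall x, nondecreasing_seq (F ^~ x)) ->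
  kop mu k th (fun x => limn (F ^~ x)) s = limn (fun n => kop mu k th (F n) s).
Proof.
move=> nF ndF; rewrite /kop -nn_integral_lim; last 2 first.
- by move=> n; exact: nnmf_kop_integrand.
- by move=> y m n mn; apply: lee_wpmul2l; [rewrite lee_fin; exact: dk.2|exact: ndF].
apply: eq_integral => y _; rewrite limeMl//.
exact: ereal_nondecreasing_is_cvgn.
Qed.

End kop_lemmas.

Section iter_kop.
Context (dS d : measure_display) (S : measurableType dS)
  (T : measurableType d) (R : realType)
  (mu : {sigma_finite_measure set T -> \bar R}) (k : T -> S -> R)
  (th : S * T -> S) (dk : kernel_density k) (mth : measurable_fun setT th).
Implicit Types F G : S -> \bar R.
Local Notation op := (kop mu k th).

Lemma nnmf_iter n F : nnmf F -> nnmf (iter n op F).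
Proof. by move=> nF; elim: n => //= n IH; exact: nnmf_kop. Qed.

Lemma iter_kop_le n F G s : nnmf F -> nnmf G -> (forall x, F x <= G x) ->
  iter n op F s <= iter n op G s.
Proof.
move=> nF nG FG; elim: n s => //= n IH s.
by apply: kop_le => //; exact: nnmf_iter.
Qed.

Lemma iter_kopD n F G s : nnmf F -> nnmf G ->
  iter n op (fun x => F x + G x) s = iter n op F s + iter n op G s.
Proof.
move=> nF nG; elim: n s => //= n IH s.
by rewrite -kopD//; [congr kop; apply/funext|exact: nnmf_iter..].
Qed.

Lemma iter_kopZ n (c : R) F s : (0 <= c)%R -> nnmf F ->
  iter n op (fun x => c%:E * F x) s = c%:E * iter n op F s.
Proof.
move=> c0 nF; elim: n s => //= n IH s.
by rewrite -kopZ//; [congr kop; apply/funext|exact: nnmf_iter].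
Qed.

End iter_kop.

(** * The chain and its running sums *)

Section chain_operators.
Context (d : measure_display) (T : measurableType d) (R : realType)
  (mu : {sigma_finite_measure set T -> \bar R}).
Implicit Types f G : T -> T -> R.

Definition trans f : (T -> \bar R) -> T -> \bar R :=
  kop (S := T) (S' := T) mu f snd.

(** The state [(x, s)] is the last observation together with the sum of the
    increments [G (X_j) (X_(j-1))] accumulated so far. *)
Definition add_incr G (z : (T * R) * T) : T * R := (z.2, (z.1.2 + G z.2 z.1.1)%R).

Definition sum_trans f G : (T * R -> \bar R) -> T * R -> \bar R :=
  kop mu (fun y (z : T * R) => f y z.1) (add_incr G).

Lemma transition_kernel f : transition_density mu f -> kernel_density f.
Proof.
move=> [mf f0 _]; split=> //.
apply: (measurableT_comp mf (g := fun z : T * T => (z.2, z.1))).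
by apply: measurable_fun_pair; [exact: measurable_snd|exact: measurable_fst].
Qed.

Lemma sum_kernel f : kernel_density f ->
  kernel_density (fun y (z : T * R) => f y z.1).
Proof.
move=> [mf f0]; split=> //.
apply: (measurableT_comp mf (g := fun z : (T * R) * T => (z.1.1, z.2))).
apply: measurable_fun_pair; last exact: measurable_snd.
by apply: measurableT_comp; [exact: measurable_fst|exact: measurable_fst].
Qed.

Lemma measurable_add_incr G :
  measurable_fun setT (fun z : T * T => G z.1 z.2) ->
  measurable_fun setT (add_incr G).
Proof.
move=> mG; apply: measurable_fun_pair; first exact: measurable_snd.
apply: measurable_funD.
  by apply: measurableT_comp; [exact: measurable_snd|exact: measurable_fst].
apply: (measurableT_comp mG (g := fun z : (T * R) * T => (z.2, z.1.1))).
apply: measurable_fun_pair; first exact: measurable_snd.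
by apply: measurableT_comp; [exact: measurable_fst|exact: measurable_fst].
Qed.

Lemma iter_sum_trans_fst n f G (F : T -> \bar R) z :
  iter n (sum_trans f G) (F \o fst) z = iter n (trans f) F z.1.
Proof.
elim: n z => //= n IH z; rewrite /sum_trans /trans /kop.
by apply: eq_integral => y _; rewrite IH.
Qed.

(** The increments do not depend on the running sum. *)
Lemma iter_sum_trans_shift n f G (F : T * R -> \bar R) x s a :
  iter n (sum_trans f G) F (x, (s + a)%R) =
  iter n (sum_trans f G) (fun z => F (z.1, (z.2 + a)%R)) (x, s).
Proof.
elim: n x s => //= n IH x s; rewrite /sum_trans /kop.
by apply: eq_integral => y _; rewrite /add_incr /= addrAC IH.
Qed.

Section process.
Context (d' : measure_display) (Om : measurableType d')
  (P : probability Om R) (X : nat -> {mfun Om >-> T})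
  (init : set T -> \bar R) (p : nat -> T -> T -> R)
  (tp : forall n, transition_density mu (p n))
  (PX : markov_law mu P X init p).

Lemma history_fun n i : (i <= n)%N ->
  measurable_fun (setT : set (g_sigma_algebraType
    (\bigcup_(i in [set i | (i <= n)%N])
        preimage_set_system setT (X i) measurable)))
   (X i : g_sigma_algebraType _ -> T).
Proof.
move=> ni _ B mB; apply: sub_sigma_algebra.
by exists i => //; exists B.
Qed.

(** The state at time [k + n] is a function of the history, so one more step of
    the process is one more application of the operator. *)
Lemma process_state G k n (F : T * R -> \bar R) f :
  measurable_fun setT (fun z : T * T => G z.1 z.2) ->
  (forall i, (i < n)%N -> p (k + i).+1 = f) -> nnmf F ->
  \int[P]_w F (X (k + n)%N w,
               (\sum_(i < n) G (X (k + i).+1 w) (X (k + i)%N w))%R) =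
  \int[P]_w iter n (sum_trans f G) F (X k w, 0%R).
Proof.
move=> mG; elim: n F => [|n IH] F pf nF.
  by apply: eq_integral => w _; rewrite addn0 big_ord0.
have df : kernel_density f.
  by rewrite -(pf 0%N)//; exact: (transition_kernel (tp _)).
have nF' : nnmf (sum_trans f G F).
  by apply: nnmf_kop => //; [exact: sum_kernel|exact: measurable_add_incr].
rewrite iterSr -(IH _ _ nF'); last by move=> i /leqW; exact: pf.
pose H w := (X (k + n)%N w,
  (\sum_(i < n) G (X (k + i).+1 w) (X (k + i)%N w))%R).
rewrite addnS.
transitivity (\int[P]_w (F \o add_incr G) (H w, X (k + n).+1 w)).
  by apply: eq_integral => w _; rewrite big_ord_recr.
rewrite (markov_step tp PX (n := (k + n)%N)); last 2 first.
- move=> A mA; rewrite -[X in history _ _ X]setTI.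
  pose gs : set (set Om) := \bigcup_(i in [set i | (i <= k + n)%N])
        preimage_set_system setT (X i) measurable.
  suff mH : measurable_fun (setT : set (g_sigma_algebraType gs))
      (H : g_sigma_algebraType gs -> _) by exact: mH.
  apply: measurable_fun_pair; first exact: history_fun.
  apply: measurable_sum => i; apply: (measurableT_comp mG
    (g := fun w : g_sigma_algebraType gs => (X (k + i).+1 w, X (k + i)%N w))).
  apply: measurable_fun_pair; apply: history_fun.
    by rewrite -addnS leq_add2l.
  by rewrite leq_add2l ltnW.
- by apply: nnmf_comp => //; exact: measurable_add_incr.
by apply: eq_integral => w _; rewrite pf.
Qed.

Lemma process_trans k n (F : T -> \bar R) f :
  (forall i, (i < n)%N -> p (k + i).+1 = f) -> nnmf F ->
  \int[P]_w F (X (k + n)%N w) = \int[P]_w iter n (trans f) F (X k w).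
Proof.
move=> pf nF; pose G := fun _ _ : T => 0%R : R.
transitivity (\int[P]_w iter n (sum_trans f G) (F \o fst) (X k w, 0%R)).
  rewrite -process_state//.
  by apply: nnmf_comp => //; exact: measurable_fst.
by apply: eq_integral => w _; rewrite iter_sum_trans_fst.
Qed.

Lemma process_init (m : {measure set T -> \bar R}) (F : T -> \bar R) :
  (forall A, measurable A -> init A = m A) -> nnmf F -> \int[P]_w F (X 0%N w) = \int[m]_x F x.
Proof.
move=> im nF.
transitivity (\int[m]_x ((cst 1%R x)%:E * F (id x))); last first.
  by apply: eq_integral => x _; rewrite mul1e.
apply: integral_density_ext => // A mA.
transitivity (init A); first exact: PX.1.
rewrite im// -[A in LHS]setIT -integral_indic//.
by apply: eq_integral => x _; rewrite mul1e.
Qed.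

End process.
End chain_operators.

(** * Regeneration on the small set *)

Section regeneration.
Context (d : measure_display) (T : measurableType d) (R : realType)
  (mu : {sigma_finite_measure set T -> \bar R}) (f : T -> T -> R)
  (tf : transition_density mu f) (C : set T) (mC : measurable C)
  (muC : mu C < +oo) (m : R) (m0 : (0 < m)%R)
  (fm : forall x y, C x -> C y -> (m <= f y x)%R).

(** From a point of [C] the chain restarts with the subprobability density
    [m * \1_C]; the residual density is what is left. *)
Definition residual (y x : T) : R := (f y x - \1_C x * (m * \1_C y))%R.

Definition regen (h : T -> \bar R) : \bar R :=
  \int[mu]_y ((m * \1_C y)%:E * h y).

Definition regen_mass : R := (m * fine (mu C))%R.

Let df := transition_kernel tf.

Lemma residual_kernel : kernel_density residual.
Proof.
split=> [|y x]; last first.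
  rewrite /residual subr_ge0 !indicE.
  have f0 := df.2 y x.
  have [xC|_] := boolP (x \in C); last by rewrite mul0r.
  have [yC|_] := boolP (y \in C); last by rewrite !mulr0.
  by rewrite mul1r mulr1 fm//; exact/set_mem.
apply: measurable_funB; first exact: df.1.
apply: measurable_funM.
  by apply: (measurableT_comp (measurable_indic mC)); exact: measurable_fst.
apply: measurable_funM; first exact: measurable_cst.
by apply: (measurableT_comp (measurable_indic mC)); exact: measurable_snd.
Qed.

Lemma nnmf_mindic : nnmf (fun y => (m * \1_C y)%:E : \bar R).
Proof.
under [X in nnmf X]eq_fun do rewrite EFinM.
by apply: nnmfZ; [exact: ltW|exact: nnmf_indic].
Qed.

Lemma regen_split x (h : T -> \bar R) : nnmf h ->
  \int[mu]_y ((f y x)%:E * h y) =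
  \int[mu]_y ((residual y x)%:E * h y) + (\1_C x)%:E * regen h.
Proof.
move=> nh; have x0 : (0 <= \1_C x :> R)%R by rewrite indicE.
have n1 : nnmf (fun y => (residual y x)%:E * h y).
  exact: (nnmf_kop_integrand (S := T) (th := snd) residual_kernel
    measurable_snd x nh).
have n2 : nnmf (fun y => (m * \1_C y)%:E * h y).
  by apply: nnmfM => //; exact: nnmf_mindic.
rewrite -nn_integralZ// -nn_integralD//; last exact: nnmfZ.
apply: eq_integral => y _; rewrite muleA -EFinM -ge0_muleDl.
- by rewrite -EFinD subrK.
- by rewrite lee_fin; exact: residual_kernel.2.
- by rewrite lee_fin !mulr_ge0// ?ltW// indicE.
Qed.

Lemma trans_split x (h : T -> \bar R) : nnmf h ->
  trans mu f h x = trans mu residual h x + (\1_C x)%:E * regen h.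
Proof. exact: regen_split. Qed.

Lemma regen_ge0 h : nnmf h -> 0 <= regen h.
Proof.
by move=> nh; apply: nn_integral_ge0; apply: nnmfM => //; exact: nnmf_mindic.
Qed.

Lemma regen_le h h' : nnmf h -> nnmf h' -> (forall y, h y <= h' y) ->
  regen h <= regen h'.
Proof.
move=> nh nh' hh; apply: nn_le_integral => [||y].
- by apply: nnmfM => //; exact: nnmf_mindic.
- by apply: nnmfM => //; exact: nnmf_mindic.
by apply: lee_wpmul2l => //; case: nnmf_mindic => _; exact.
Qed.

Lemma regenD h h' : nnmf h -> nnmf h' ->
  regen (fun y => h y + h' y) = regen h + regen h'.
Proof.
move=> nh nh'; rewrite /regen -nn_integralD.
- by apply: eq_integral => y _; rewrite ge0_muleDr//; [case: nh|case: nh'].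
- by apply: nnmfM => //; exact: nnmf_mindic.
- by apply: nnmfM => //; exact: nnmf_mindic.
Qed.

Lemma regenZ (c : R) h : (0 <= c)%R -> nnmf h ->
  regen (fun y => c%:E * h y) = c%:E * regen h.
Proof.
move=> c0 nh; rewrite /regen -nn_integralZ//.
- by apply: eq_integral => y _; rewrite muleCA.
- by apply: nnmfM => //; exact: nnmf_mindic.
Qed.

Lemma regen_sum (I : Type) (r : seq I) (h : I -> T -> \bar R) :
  (forall i, nnmf (h i)) ->
  regen (fun y => \sum_(i <- r) h i y) = \sum_(i <- r) regen (h i).
Proof.
move=> nh; rewrite /regen -nn_integral_sum; last first.
  by move=> i; apply: nnmfM => //; exact: nnmf_mindic.
by apply: eq_integral => y _; rewrite ge0_sume_distrr// => i _; case: (nh i).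
Qed.

Lemma regen_cst (c : R) : (0 <= c)%R -> regen (cst c%:E) = (c * regen_mass)%:E.
Proof.
move=> c0; rewrite /regen.
under eq_integral do rewrite /= -EFinM mulrC mulrA EFinM.
rewrite nn_integralZ//; [|by rewrite mulr_ge0// ltW|exact: nnmf_indic].
rewrite integral_indic// setIT /regen_mass mulrA [RHS]EFinM fineK//.
by rewrite ge0_fin_numE.
Qed.

Lemma trans_cst (c : R) x : (0 <= c)%R -> trans mu f (cst c%:E) x = c%:E.
Proof.
move=> c0; rewrite /trans /kop/=.
under eq_integral do rewrite muleC.
rewrite nn_integralZ//; first by case: tf => _ _ ->; rewrite mule1.
apply: nnmf_EFin; last by move=> y; exact: df.2.
apply: (measurableT_comp df.1 (g := fun y => (x, y))).
by apply: measurable_fun_pair => //; exact: measurable_cst.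
Qed.

Lemma residual_cst x : trans mu residual (cst 1) x = (1 - regen_mass * \1_C x)%:E.
Proof.
have n1 : nnmf (cst 1 : T -> \bar R) by exact: nnmf_cst.
have := trans_split x n1; rewrite trans_cst// regen_cst//.
rewrite mul1r -EFinM [(\1_C x * _)%R]mulrC => h.
by rewrite EFinB [X in _ = X - _]h addeK.
Qed.

End regeneration.

(** * The drift condition *)

Section drift.
Context (d : measure_display) (T : measurableType d) (R : realType)
  (mu : {sigma_finite_measure set T -> \bar R}) (f : T -> T -> R)
  (tf : transition_density mu f) (C : set T) (mC : measurable C)
  (V : T -> R) (mV : measurable_fun setT V) (V1 : forall x, (1 <= V x)%R)
  (rho D : R) (rho01 : (0 < rho < 1)%R) (D0 : (0 < D)%R)
  (drift : forall x,
    trans mu f (EFin \o V) x <= ((1 - rho) * V x + D * \1_C x)%:E).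

Let df := transition_kernel tf.

Let V0 x : (0 <= V x)%R. Proof. exact: le_trans (V1 x). Qed.

Lemma nnmf_V : nnmf (EFin \o V). Proof. exact: nnmf_EFin. Qed.

Section invariant.
Context (lambda : probability T R) (lambda_inv : forall B, measurable B ->
  lambda B = \int[lambda]_x \int[mu]_(y in B) (f y x)%:E).

Lemma invariant_integral F : nnmf F ->
  \int[lambda]_x F x = \int[lambda]_x trans mu f F x.
Proof.
move=> nF; pose K (z : T * T) := f z.2 z.1.
have fub h : nnmf h -> \int[lambda \x mu]_z ((K z)%:E * h z.2) =
    \int[lambda]_x trans mu f h x.
  move=> nh; rewrite fubini_tonelli1//.
    apply: emeasurable_funM; first by apply/measurable_EFinP; exact: df.1.
    by apply: measurableT_comp; [case: nh|exact: measurable_snd].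
  by move=> z; apply: mule_ge0; [rewrite lee_fin; exact: df.2|case: nh].
rewrite -fub//; apply: (integral_density_ext (G' := id) (K := K) (G := snd)) => //.
- exact: df.1.
- by move=> z; exact: df.2.
- move=> A mA; rewrite (fub (fun x => (\1_A x)%:E)); last exact: nnmf_indic.
  rewrite preimage_id.
  transitivity (\int[lambda]_x \int[mu]_(y in A) (f y x)%:E).
    exact: lambda_inv.
  apply: eq_integral => x _.
  rewrite integral_mkcond; apply: eq_integral => y _ /=.
  by rewrite patchE indicE; case: ifPn => _; rewrite (mule1, mule0).
Qed.

(** Truncating the drift inequality at the level [N] before integrating it
    keeps all the terms finite; the truncated functions increase to [V]. *)
Lemma invariant_drift :
  rho%:E * \int[lambda]_x (V x)%:E <= D%:E * lambda C.
Proof.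
have /andP[r0 r1] := rho01.
pose I N x := (\1_[set x | (V x <= N%:R)%R] x : R).
have mI N : measurable [set x | (V x <= N%:R)%R].
  rewrite -[X in measurable X]setTI.
  by apply: measurable_fun_le => //; exact: measurable_cst.
have nVI N : nnmf (fun x => (V x * I N x)%:E).
  apply: nnmf_EFin; first by apply: measurable_funM => //; exact: measurable_indic.
  by move=> x; rewrite mulr_ge0// /I indicE.
have step (N : nat) : rho%:E * \int[lambda]_x (V x * I N x)%:E <= D%:E * lambda C.
  pose VN x := Num.min (V x) N%:R.
  pose wN x := Num.min ((1 - rho) * V x)%R N%:R.
  have N0 : (0 <= N%:R :> R)%R by [].
  have nVN : nnmf (EFin \o VN).
    apply: nnmf_EFin; first by apply: measurable_minr => //; exact: measurable_cst.
    by move=> x; rewrite le_min V0 N0.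
  have nwN : nnmf (EFin \o wN).
    apply: nnmf_EFin; first by apply: measurable_minr; [exact: measurable_funM|].
    by move=> x; rewrite le_min mulr_ge0 ?subr_ge0 ?(ltW r1)//=.
  have nDC : nnmf (fun x => D%:E * (\1_C x)%:E).
    by apply: nnmfZ; [exact: ltW|exact: nnmf_indic].
  have TVN x : trans mu f (EFin \o VN) x <= (wN x)%:E + D%:E * (\1_C x)%:E.
    have h1 : trans mu f (EFin \o VN) x <= ((1 - rho) * V x + D * \1_C x)%:E.
      apply: le_trans (drift x); apply: kop_le => //; first exact: nnmf_V.
      by move=> y; rewrite lee_fin ge_min lexx.
    have h2 : trans mu f (EFin \o VN) x <= N%:R%:E.
      rewrite -(trans_cst tf x N0); apply: kop_le => //.
      by move=> y; rewrite lee_fin ge_min lexx orbT.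
    have Dc : (0 <= D * \1_C x)%R by rewrite mulr_ge0 ?indicE// ltW.
    rewrite -EFinM -EFinD /wN; case: (leP ((1 - rho) * V x)%R N%:R) => // _.
    by apply: le_trans h2 _; rewrite lee_fin lerDl.
  have key : \int[lambda]_x (wN x)%:E + rho%:E * \int[lambda]_x (V x * I N x)%:E
      <= \int[lambda]_x (wN x)%:E + D%:E * lambda C.
    apply: (@le_trans _ _ (\int[lambda]_x (VN x)%:E)).
      rewrite -nn_integralZ//; last exact: ltW.
      rewrite -nn_integralD//; last by apply: nnmfZ => //; exact: ltW.
      apply: nn_le_integral => //.
        by apply: nnmfD => //; apply: nnmfZ => //; exact: ltW.
      move=> x; rewrite -EFinM -EFinD lee_fin /wN /VN /I indicE.
      have := V0 x; have [VN'|VN'] := lerP (V x) N%:R => Vx.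
        rewrite mem_set//= mulr1; apply: (@le_trans _ _ ((1 - rho) * V x + rho * V x)%R).
          by rewrite lerD2r ge_min lexx.
        by rewrite -mulrDl subrK mul1r.
      rewrite memNset/=; last by apply/negP; rewrite -ltNge.
      by rewrite !mulr0 addr0 ge_min lexx orbT.
    rewrite [leLHS](invariant_integral nVN).
    apply: (@le_trans _ _ (\int[lambda]_x ((wN x)%:E + D%:E * (\1_C x)%:E))).
      apply: nn_le_integral => //; last exact: nnmfD.
      by apply: nnmf_kop => //; exact: measurable_snd.
    rewrite nn_integralD// nn_integralZ//; [|exact: ltW|exact: nnmf_indic].
    by rewrite integral_indic// setIT.
  rewrite leeD2lE in key => //.
  rewrite ge0_fin_numE; last exact: nn_integral_ge0.
  apply: (@le_lt_trans _ _ (\int[lambda]_x (cst N%:R%:E x))).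
    apply: nn_le_integral => // x.
    by rewrite lee_fin ge_min lexx orbT.
  by rewrite integral_cst//= [X in _ * X]probability_setT mule1 ltry.
have ndI x : nondecreasing_seq (fun N => (V x * I N x)%:E).
  move=> a b ab; rewrite lee_fin ler_wpM2l// /I !indicE.
  case: (boolP (x \in [set x | V x <= a%:R]%R)) => //.
  rewrite inE/= => h; rewrite mem_set//=; apply: (le_trans h).
  by rewrite ler_nat.
have cI : cvgn (fun N => \int[lambda]_x (V x * I N x)%:E).
  apply: ereal_nondecreasing_is_cvgn => a b ab.
  by apply: nn_le_integral => // x; exact: ndI.
have -> : \int[lambda]_x (V x)%:E = limn (fun N => \int[lambda]_x (V x * I N x)%:E).
  rewrite -nn_integral_lim//.
    apply: eq_integral => x _; apply/esym/cvg_lim => //.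
    apply: cvg_near_cst; near=> N.
    rewrite /I indicE mem_set/= ?mulr1//.
    near: N; exists (Num.bound (V x)) => // N /= hN.
    apply: (le_trans (ltW (archi_boundP (V0 x)))); rewrite ler_nat//.
rewrite -limeMl//.
  apply: lime_le; last by apply: nearW => N; exact: step.
  exact: is_cvgeZl.
Unshelve. all: by end_near. Qed.

End invariant.
End drift.

(** * The Poisson equation *)

(** Geometric drift towards a set on which the density is bounded below: a
    one-step form of the drift condition (V4) of Meyn and Tweedie. *)
Record geometric_drift (d : measure_display) (T : measurableType d)
    (R : realType) (mu : {sigma_finite_measure set T -> \bar R})
    (f : T -> T -> R) (C : set T) (m rho D : R) (V : T -> R) : Prop := GeometricDrift {
  gd_density : transition_density mu f ;
  gd_measurable_set : measurable C ;
  gd_finite : mu C < +oo ;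
  gd_minor_gt0 : (0 < m)%R ;
  gd_minor : forall x y, C x -> C y -> (m <= f y x)%R ;
  gd_measurable : measurable_fun setT V ;
  gd_ge1 : forall x, (1 <= V x)%R ;
  gd_rate : (0 < rho < 1)%R ;
  gd_const_gt0 : (0 < D)%R ;
  gd_drift : forall x,
    trans mu f (EFin \o V) x <= ((1 - rho) * V x + D * \1_C x)%:E
}.

Section poisson.
Context (d : measure_display) (T : measurableType d) (R : realType)
  (mu : {sigma_finite_measure set T -> \bar R}) (f : T -> T -> R)
  (C : set T) (m rho D : R) (V : T -> R)
  (gd : geometric_drift mu f C m rho D V)
  (lambda : probability T R)
  (lambda_inv : forall B, measurable B ->
    lambda B = \int[lambda]_x \int[mu]_(y in B) (f y x)%:E).

Let tf := gd_density gd.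
Let df := transition_kernel tf.
Let mC := gd_measurable_set gd.
Let mV := gd_measurable gd.
Let V1 := gd_ge1 gd.
Let rho0 : (0 < rho)%R. Proof. by have /andP[] := gd_rate gd. Qed.
Let D0 := gd_const_gt0 gd.
Let V0 x : (0 <= V x)%R. Proof. exact: le_trans (V1 x). Qed.
Let nV : nnmf (EFin \o V). Proof. exact: nnmf_EFin. Qed.

Let drift_integral :
  rho%:E * \int[lambda]_x (V x)%:E <= D%:E * lambda C.
Proof. exact: (invariant_drift tf mC mV V1 (gd_rate gd) D0 (gd_drift gd)). Qed.

Let lambdaT : lambda [set: T] = 1. Proof. exact: probability_setT. Qed.

Lemma invariant_V_lty : \int[lambda]_x (V x)%:E < +oo.
Proof.
have : rho%:E * \int[lambda]_x (V x)%:E < +oo.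
  apply: le_lt_trans drift_integral _.
  apply: lte_mul_pinfty; rewrite ?lee_fin ?(ltW D0)//.
  apply: (@le_lt_trans _ _ 1); last exact: ltry.
  exact: probability_le1.
case: (\int[lambda]_x _) => [s _||//]; first exact: ltry.
by rewrite gt0_muley ?lte_fin.
Qed.

(** The integrated drift inequality forces mass on [C], because [V] is at
    least 1. *)
Lemma invariant_C_gt0 : 0 < lambda C.
Proof.
rewrite lt0e measure_ge0 andbT; apply/eqP => l0.
have := drift_integral; rewrite l0 mule0 leNgt => /negP; apply.
rewrite mule_gt0 ?lte_fin//; apply: (@lt_le_trans _ _ 1) => //.
rewrite -lambdaT -[X in X <= _]mul1e -integral_cst//.
by apply: nn_le_integral.
Qed.

(** Invariance makes [lambda] absolutely continuous with respect to [mu]. *)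
Lemma small_set_gt0 : 0 < mu C.
Proof.
rewrite lt0e measure_ge0 andbT; apply/eqP => m0.
have := invariant_C_gt0; rewrite [lambda C]lambda_inv//.
rewrite [X in _ < X](_ : _ = 0) ?ltxx//; apply: integral0_eq => x _.
apply: null_set_integral => //; apply: measurable_funTS.
apply/measurable_EFinP.
apply: (measurableT_comp df.1 (g := fun y => (x, y))).
by apply: measurable_fun_pair => //; exact: measurable_cst.
Qed.

Let delta := regen_mass mu C m.

Lemma regen_mass_gt0 : (0 < delta)%R.
Proof.
rewrite mulr_gt0 ?(gd_minor_gt0 gd)// fine_gt0// small_set_gt0.
exact: (gd_finite gd).
Qed.

Local Notation Q := (trans mu (residual f C m)).
Let dQ : kernel_density (residual f C m) :=
  residual_kernel tf mC (gd_minor gd).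

(** The residual kernel loses mass only on [C], and the constant [D / delta]
    pays for the term [D] of the drift condition by the mass lost there; hence
    [W] decreases by [V] at each residual step. *)
Definition potential (x : T) : R := ((V x + D / delta) / rho)%R.
Local Notation W := potential.

Let Dd : (0 < D / delta)%R.
Proof. by rewrite divr_gt0// regen_mass_gt0. Qed.

Lemma potential_ge0 x : (0 <= W x)%R.
Proof. by rewrite divr_ge0 ?addr_ge0// ltW. Qed.

Lemma nnmf_potential : nnmf (EFin \o W).
Proof.
apply: nnmf_EFin; last exact: potential_ge0.
apply: measurable_funM; last exact: measurable_cst.
by apply: measurable_funD => //; exact: measurable_cst.
Qed.

Lemma potential_le_V x : (W x <= (1 + D / delta) / rho * V x)%R.
Proof.
rewrite /W mulrAC ler_pM2r ?invr_gt0// mulrDl mul1r lerD2l.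
by rewrite ler_peMr// ltW.
Qed.

Lemma potential_decrease x : (V x)%:E + Q (EFin \o W) x <= (W x)%:E.
Proof.
have QV : Q (EFin \o V) x <= ((1 - rho) * V x + D * \1_C x)%:E.
  apply: le_trans (gd_drift gd x).
  rewrite (trans_split tf mC (gd_minor_gt0 gd) (gd_minor gd) x nV).
  rewrite leeDl// mule_ge0 ?lee_fin ?indicE//.
  by apply: regen_ge0 => //; exact: (gd_minor_gt0 gd).
have -> : Q (EFin \o W) x =
    rho^-1%:E * (Q (EFin \o V) x + (D / delta)%:E * Q (cst 1) x).
  have n1 : nnmf (cst 1 : T -> \bar R) by exact: nnmf_cst.
  have nD : nnmf (fun y : T => (D / delta)%:E * cst 1 y : \bar R).
    by apply: nnmfZ => //; exact: ltW.
  rewrite /trans -(kopZ mu dQ measurable_snd x (ltW Dd) n1).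
  rewrite -(kopD mu dQ measurable_snd x nV nD).
  rewrite -(kopZ mu dQ measurable_snd x _ (nnmfD nV nD)) ?invr_ge0 ?ltW//.
  congr kop; apply/funext => y /=.
  by rewrite mule1 -EFinD -EFinM /W mulrC.
rewrite (residual_cst tf mC (gd_finite gd) (gd_minor_gt0 gd) (gd_minor gd)).
rewrite -/delta -EFinM.
apply: (@le_trans _ _ ((V x)%:E + rho^-1%:E * (((1 - rho) * V x + D * \1_C x)%:E
   + (D / delta * (1 - delta * \1_C x))%:E))).
  rewrite leeD2l// lee_wpmul2l ?lee_fin ?invr_ge0 ?(ltW rho0)//.
  by rewrite leeD2r.
rewrite -EFinD lee_fin le_eqVlt; apply/orP; left; apply/eqP.
rewrite /W; field; rewrite !gt_eqF ?regen_mass_gt0//.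
Qed.

(** The iterates of [F |-> h + Q F] started at 0 increase and stay below the
    potential. *)
Lemma resolvent (h : T -> R) : measurable_fun setT h ->
  (forall x, (0 <= h x <= V x)%R) ->
  exists a : T -> R, [/\ measurable_fun setT a, forall x, (0 <= a x <= W x)%R
    & forall x, (a x)%:E = (h x)%:E + Q (EFin \o a) x].
Proof.
move=> mh hV; have h0 x : (0 <= h x)%R by have /andP[] := hV x.
have nh : nnmf (EFin \o h) by exact: nnmf_EFin.
pose step (F : T -> \bar R) x := (h x)%:E + Q F x.
pose A n := iter n step (cst 0).
have nA n : nnmf (A n).
  elim: n => [|n IH]; first exact: nnmf_cst.
  by apply: nnmfD => //; apply: nnmf_kop => //; exact: measurable_snd.
have stepA n x : A n x <= A n.+1 x.
  elim: n x => [|n IH] x; first by have [_] := nA 1%N; exact.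
  by rewrite leeD2l//; exact: (kop_le mu dQ measurable_snd x (nA n) (nA n.+1) IH).
have ndA x : nondecreasing_seq (A ^~ x).
  by apply/nondecreasing_seqP => n; exact: stepA.
have AW n x : A n x <= (W x)%:E.
  elim: n x => [|n IH] x; first by rewrite lee_fin potential_ge0.
  apply: le_trans (potential_decrease x); apply: leeD.
    by rewrite lee_fin; have /andP[] := hV x.
  exact: (kop_le mu dQ measurable_snd x (nA n) nnmf_potential IH).
pose a x := limn (A ^~ x).
have na : nnmf a by exact: nnmf_lim.
have cA x : cvgn (A ^~ x) by exact: ereal_nondecreasing_is_cvgn.
have aW x : a x <= (W x)%:E by apply: lime_le => //; exact: nearW.
have afin x : a x \is a fin_num.
  by rewrite ge0_fin_numE ?(le_lt_trans (aW x)) ?ltry//; case: na.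
have aE : EFin \o (fine \o a) = a by apply/funext => x /=; rewrite fineK.
exists (fine \o a); split.
- by case: na => ma _; apply/measurable_EFinP; rewrite aE.
- by move=> x; rewrite -2!lee_fin /= fineK// aW andbT; case: na.
- move=> x; rewrite aE /= fineK//.
  apply/cvg_lim => //; rewrite -cvg_shiftS.
  apply: cvgeD; [exact: fin_num_adde_defr|exact: cvg_cst|].
  rewrite /trans (kop_lim mu dQ measurable_snd)//.
  apply: ereal_nondecreasing_is_cvgn => i j ij.
  exact: (kop_le mu dQ measurable_snd x (nA i) (nA j) (fun y => ndA y _ _ ij)).
Qed.

(** Adding the part of the transition that regenerates replaces [Q] by the full
    transition operator and leaves a multiple of the indicator of [C], which
    integration against [lambda] determines. *)
Lemma poisson_atom (h : T -> R) : measurable_fun setT h ->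
  (forall x, (0 <= h x <= V x)%R) ->
  exists a : T -> R, [/\ measurable_fun setT a, forall x, (0 <= a x <= W x)%R
    & forall x, trans mu f (EFin \o a) x =
      (a x - h x + fine (\int[lambda]_y (h y)%:E) * (\1_C x / fine (lambda C)))%:E].
Proof.
move=> mh hV; have h0 x : (0 <= h x)%R by have /andP[] := hV x.
have nh : nnmf (EFin \o h) by exact: nnmf_EFin.
have [a [ma aW aE]] := resolvent mh hV; exists a; split => //.
have a0 x : (0 <= a x)%R by have /andP[] := aW x.
have na : nnmf (EFin \o a) by exact: nnmf_EFin.
pose al := regen mu C m (EFin \o a).
have al0 : 0 <= al by apply: regen_ge0 => //; exact: (gd_minor_gt0 gd).
have split x : (a x)%:E + (\1_C x)%:E * al = (h x)%:E + trans mu f (EFin \o a) x.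
  rewrite (trans_split tf mC (gd_minor_gt0 gd) (gd_minor gd) x na).
  by rewrite addeA -aE.
have int_le (b : T -> R) (K : R) : measurable_fun setT b ->
    (forall x, 0 <= b x <= K * V x)%R -> \int[lambda]_x (b x)%:E \is a fin_num.
  move=> mb bV; have b0 x : (0 <= b x)%R by have /andP[] := bV x.
  have nb : nnmf (EFin \o b) by exact: nnmf_EFin.
  have [x0] : exists x0 : T, True by exists point.
  move=> _; have K0 : (0 <= K)%R.
    have /andP[_] := bV x0; have := b0 x0; have := V1 x0; nra.
  rewrite ge0_fin_numE; last exact: nn_integral_ge0.
  apply: (@le_lt_trans _ _ (K%:E * \int[lambda]_x (V x)%:E)).
    rewrite -(nn_integralZ _ K0 nV); apply: nn_le_integral => //.
      exact: nnmfZ.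
    by move=> x; rewrite /= -EFinM lee_fin; have /andP[] := bV x.
  apply: lte_mul_pinfty; rewrite ?lee_fin//; exact: invariant_V_lty.
have la_fin : \int[lambda]_x (a x)%:E \is a fin_num.
  apply: (int_le _ ((1 + D / delta) / rho)%R) => // x.
  have /andP[-> aW'] /= := aW x; apply: le_trans aW' _; exact: potential_le_V.
have lh_fin : \int[lambda]_x (h x)%:E \is a fin_num.
  by apply: (int_le _ 1%R) => // x; rewrite mul1r.
have lC : al * lambda C = \int[lambda]_x (h x)%:E.
  have nal : nnmf (fun x => (\1_C x)%:E * al).
    by apply: nnmfM; [exact: nnmf_indic|exact: nnmf_cst].
  have : \int[lambda]_x ((a x)%:E + (\1_C x)%:E * al) =
      \int[lambda]_x ((h x)%:E + trans mu f (EFin \o a) x).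
    by apply: eq_integral => x _; exact: split.
  rewrite (nn_integralD _ na nal) nn_integralD//; last first.
    by apply: nnmf_kop => //; exact: measurable_snd.
  rewrite -(invariant_integral tf lambda_inv na) addeC.
  move=> /(congr1 (fun z => z - \int[lambda]_x (a x)%:E)).
  rewrite addeK// addeK// => <-.
  rewrite ge0_integralZr//.
    by rewrite integral_indic// setIT muleC.
  by case: (nnmf_indic R mC).
have lCfin : lambda C \is a fin_num by exact: fin_num_measure.
have lCp : (0 < fine (lambda C))%R.
  by rewrite fine_gt0// invariant_C_gt0 -ge0_fin_numE.
have alE : al = (fine (\int[lambda]_y (h y)%:E) / fine (lambda C))%:E.
  have : al * (fine (lambda C))%:E = (fine (\int[lambda]_x (h x)%:E))%:E.
    by rewrite !fineK.
  case: (al) al0 => [s _|_|//]; last by rewrite gt0_mulye.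
  by rewrite -EFinM => -[<-]; rewrite mulfK// gt_eqF.
move=> x; have := split x; rewrite alE -EFinM -EFinD.
move=> /(congr1 (fun z => z - (h x)%:E)); rewrite [X in _ = X - _]addeC addeK// => <-.
by rewrite -EFinB; congr EFin; rewrite mulrCA; ring.
Qed.

(** Solutions for [h] and for the constant 1 have proportional masses under
    regeneration, so that in their combination the terms on [C] cancel. *)
Lemma poisson_solution (h : T -> R) : measurable_fun setT h ->
  (forall x, (0 <= h x <= V x)%R) ->
  let I := fine (\int[lambda]_x (h x)%:E) in
  exists (u : T -> R) (K : R), [/\ measurable_fun setT u,
    forall x, (`|u x| <= K * V x)%R,
    forall x, mu.-integrable setT (fun y => (f y x * u y)%:E) &
    forall x, \int[mu]_y (f y x * u y)%:E = (u x - h x + I)%:E].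
Proof.
move=> mh hV I; have h0 x : (0 <= h x)%R by have /andP[] := hV x.
have [a [ma aW aE]] := poisson_atom mh hV.
have [|b [mb bW bE]] := @poisson_atom (cst 1%R) (measurable_cst _).
  by move=> x; rewrite /= ler01 V1.
have a0 x : (0 <= a x)%R by have /andP[] := aW x.
have b0 x : (0 <= b x)%R by have /andP[] := bW x.
have I0 : (0 <= I)%R by apply: fine_ge0; exact: nn_integral_ge0 (nnmf_EFin mh h0).
pose u x := (a x - I * b x)%R.
have mfx x : measurable_fun setT (fun y => f y x).
  apply: (measurableT_comp df.1 (g := fun y => (x, y))).
  by apply: measurable_fun_pair => //; exact: measurable_cst.
have intf (c : T -> R) x s : measurable_fun setT c -> (forall y, 0 <= c y)%R ->
    trans mu f (EFin \o c) x = s%:E ->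
    mu.-integrable setT (fun y => (f y x * c y)%:E).
  move=> mc c0 E; apply/integrableP; split.
    by apply/measurable_EFinP; exact: measurable_funM.
  under eq_integral do rewrite gee0_abs ?lee_fin ?mulr_ge0 ?df.2//.
  by move: E; rewrite /trans /kop /= => ->; rewrite ltry.
have inta x := intf _ x _ ma a0 (aE x).
have intb x := intf _ x _ mb b0 (bE x).
have uE x : (fun y => (f y x * u y)%:E) =
    (fun y => (f y x * a y)%:E - I%:E * (f y x * b y)%:E).
  by apply/funext => y; rewrite -EFinM -EFinB /u; congr EFin; ring.
have intIb x : mu.-integrable setT (fun y => I%:E * (f y x * b y)%:E).
  exact: integrableZl.
exists u, ((1 + I) * ((1 + D / delta) / rho))%R; split.
- by apply: measurable_funB => //; apply: measurable_funM.
- move=> x; rewrite -mulrA; apply: (@le_trans _ _ ((1 + I) * W x)%R); last first.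
    by rewrite ler_wpM2l ?addr_ge0//; exact: potential_le_V.
  have /andP[ax0 axW] := aW x; have /andP[bx0 bxW] := bW x.
  rewrite /u ler_norml; have := potential_ge0 x; nra.
- by move=> x; rewrite uE; exact: integrableB.
move=> x; rewrite uE integralB// integralZl//.
have -> : \int[mu]_y (f y x * a y)%:E = trans mu f (EFin \o a) x by [].
have -> : \int[mu]_y (f y x * b y)%:E = trans mu f (EFin \o b) x by [].
rewrite aE bE -EFinM -EFinB; congr EFin; rewrite -/I /u.
have -> : fine (\int[lambda]_y (cst 1%R y)%:E) = 1%R.
  have -> : \int[lambda]_y (cst 1%R y)%:E = \int[lambda]_y (cst 1 y) by [].
  by rewrite integral_cst//= mul1e lambdaT.
by rewrite mul1r /=; ring.
Qed.

End poisson.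

(** * Moments of the centred sums *)

Definition exceeds (T : Type) (R : realType) (t : R) (z : T * R) : \bar R :=
  (\1_[set z : T * R | (t < `|z.2|)%R] z)%:E.

Lemma nnmf_exceeds (d : measure_display) (T : measurableType d) (R : realType)
  (t : R) : nnmf (@exceeds T R t).
Proof.
apply: nnmf_indic.
rewrite (_ : [set z | _] = ~` [set z : T * R | (`|z.2| <= t)%R]); last first.
  by apply/seteqP; split=> z /=; [move/lt_geF => ->|move/negP; rewrite -ltNge].
apply: measurableC; rewrite -[X in measurable X]setTI.
apply: measurable_fun_le => //.
by apply: (measurableT_comp (@normr_measurable R setT)); exact: measurable_snd.
Qed.

Section moments.
Context (d : measure_display) (T : measurableType d) (R : realType)
  (mu : {sigma_finite_measure set T -> \bar R}) (f : T -> T -> R)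
  (tf : transition_density mu f) (G : T -> T -> R)
  (mG : measurable_fun setT (fun z : T * T => G z.1 z.2)).

Let df := transition_kernel tf.
Let dS := sum_kernel df.
Let mS := measurable_add_incr mG.
Local Notation P := (trans mu f).
Local Notation SP := (sum_trans mu f G).

Lemma nnmf_trans F : nnmf F -> nnmf (P F).
Proof. by move=> nF; apply: nnmf_kop => //; exact: measurable_snd. Qed.

Lemma nnmf_iter_trans n F : nnmf F -> nnmf (iter n P F).
Proof. by move=> nF; apply: nnmf_iter => //; exact: measurable_snd. Qed.

Lemma nnmf_iter_sum_trans n F : nnmf F -> nnmf (iter n SP F).
Proof. by move=> nF; apply: nnmf_iter. Qed.

Lemma nnmf_sum_start n F : nnmf F -> nnmf (fun x => iter n SP F (x, 0%R)).
Proof.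
move=> /(nnmf_iter_sum_trans n) nF.
apply: (nnmf_comp _ nF (th := fun x : T => (x, 0%R : R))).
by apply: measurable_fun_pair => //; exact: measurable_cst.
Qed.

Lemma iter_sum_trans_le n F F' z : nnmf F -> nnmf F' ->
  (forall z, F z <= F' z) -> iter n SP F z <= iter n SP F' z.
Proof. by move=> *; apply: iter_kop_le. Qed.

Lemma nnmf_fst (h : T -> \bar R) : nnmf h -> nnmf (h \o fst : T * R -> \bar R).
Proof. by move=> nh; apply: nnmf_comp => //; exact: measurable_fst. Qed.

(** A discrete Gronwall inequality. *)
Lemma iter_sum_trans_drift (F : T * R -> \bar R) (h : T -> \bar R) (k b : R) :
  nnmf F -> nnmf h -> (1 <= k)%R -> (0 <= b)%R ->
  (forall z, SP F z <= k%:E * F z + b%:E * h z.1) ->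
  forall n z, iter n SP F z <=
    (k ^+ n)%:E * (F z + b%:E * \sum_(0 <= j < n) iter j P h z.1).
Proof.
move=> nF nh k1 b0 H.
have k0 : (0 <= k)%R by exact: le_trans k1.
elim=> [|n IH] z; first by rewrite big_nil mule0 adde0 mul1e.
have nP j : nnmf (iter j P h) by exact: nnmf_iter_trans.
pose hs (z : T * R) := \sum_(0 <= j < n) iter j P h z.1.
have nhs : nnmf hs by apply: nnmf_sum => j; exact: (nnmf_fst (nP j)).
have nbhs : nnmf (fun z => b%:E * hs z) by exact: nnmfZ.
have -> : iter n.+1 SP F z = SP (iter n SP F) z by [].
apply: (@le_trans _ _ (SP (fun z => (k ^+ n)%:E * (F z + b%:E * hs z)) z)).
  apply: kop_le => //; first exact: nnmf_iter_sum_trans.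
  by apply: nnmfZ; [exact: exprn_ge0|exact: nnmfD].
rewrite /sum_trans kopZ//; [|exact: exprn_ge0|exact: nnmfD].
rewrite kopD// kopZ//.
have -> : kop mu (fun y (z : T * R) => f y z.1) (add_incr G) hs z =
    \sum_(0 <= j < n) iter j.+1 P h z.1.
  by rewrite kop_sum// => j; exact: (nnmf_fst (nP j)).
rewrite exprSr EFinM -muleA lee_wpmul2l ?lee_fin ?exprn_ge0//.
apply: (@le_trans _ _ (k%:E * F z + b%:E * h z.1 +
    b%:E * \sum_(0 <= j < n) iter j.+1 P h z.1)).
  by rewrite leeD2r//; exact: H.
have s0 : 0 <= \sum_(0 <= j < n) iter j.+1 P h z.1.
  by apply: sume_ge0 => j _; case: (nP j.+1).
have h0 : 0 <= h z.1 by case: nh.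
rewrite big_nat_recl//= -addeA -ge0_muleDr//.
have bs0 : 0 <= b%:E * (h z.1 + \sum_(0 <= j < n) iter j.+1 P h z.1).
  by rewrite mule_ge0 ?lee_fin ?adde_ge0.
rewrite [leRHS]ge0_muleDr//; last by case: nF.
by rewrite leeD2l// -[leLHS]mul1e lee_wpmul2r// lee_fin.
Qed.

Section martingale.
Context (V u : T -> R) (K r : R)
  (mV : measurable_fun setT V) (V1 : forall x, (1 <= V x)%R)
  (meas_u : measurable_fun setT u) (uV : forall x, (`|u x| <= K * V x)%R)
  (r2 : (2 < r)%R).

Let phi y x : R := (G y x + u y - u x)%R.

Context
  (phi_int : forall x, mu.-integrable setT (fun y => (f y x * phi y x)%:E))
  (phi0 : forall x, \int[mu]_y (f y x * phi y x)%:E = 0).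

Let V0 x : (0 <= V x)%R. Proof. exact: le_trans (V1 x). Qed.
Let r0 : (0 <= r)%R. Proof. by apply: le_trans (ltW r2). Qed.
Let K0 : (0 <= K)%R.
Proof.
have := uV point; have := V1 point; have := normr_ge0 (u point); nra.
Qed.

Definition incr_moment (H : T -> T -> R) (x : T) : \bar R :=
  \int[mu]_y ((f y x)%:E * (`|H y x| `^ r)%:E).

Lemma nnmf_incr_pow (H : T -> T -> R) :
  measurable_fun setT (fun z : T * T => H z.1 z.2) ->
  nnmf (fun z : T * T => (`|H z.2 z.1| `^ r)%:E).
Proof.
move=> mH; apply: nnmf_EFin; last by move=> z; exact: powR_ge0.
apply: (measurableT_comp (measurable_powR r)).
apply: (measurableT_comp (@normr_measurable R setT)).
apply: (measurableT_comp mH (g := fun z : T * T => (z.2, z.1))).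
by apply: measurable_fun_pair; [exact: measurable_snd|exact: measurable_fst].
Qed.

Lemma nnmf_incr_moment (H : T -> T -> R) :
  measurable_fun setT (fun z : T * T => H z.1 z.2) -> nnmf (incr_moment H).
Proof.
move=> mH; apply: (nnmf_kop mu (th := id) df _ (nnmf_incr_pow mH)).
exact: measurable_id.
Qed.

Lemma nnmf_incr_slice (H : T -> T -> R) x :
  measurable_fun setT (fun z : T * T => H z.1 z.2) ->
  nnmf (fun y => (`|H y x| `^ r)%:E).
Proof.
move=> /nnmf_incr_pow nH; apply: (nnmf_comp _ nH (th := fun y => (x, y))).
by apply: measurable_fun_pair => //; exact: measurable_cst.
Qed.

Let mphi : measurable_fun setT (fun z : T * T => phi z.1 z.2).
Proof.
apply: measurable_funB; first apply: measurable_funD => //.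
- by apply: measurableT_comp => //; exact: measurable_fst.
- by apply: measurableT_comp => //; exact: measurable_snd.
Qed.

Let c : R := (2 * r ^+ 2 + (1 + 2 * r) `^ r)%R.
Let c0 : (0 < c)%R.
Proof.
have h : (0 < 2 * r ^+ 2)%R.
  by rewrite mulr_gt0// exprn_gt0// (lt_trans _ r2).
by apply: lt_le_trans h _; rewrite lerDl powR_ge0.
Qed.

(** The martingale with increments [phi]; its value at the state [(x, s)] is
    [s + u x]. *)
Let mart (z : T * R) : \bar R := (`|z.2 + u z.1| `^ r)%:E.

Let nmart : nnmf mart.
Proof.
apply: nnmf_EFin; last by move=> z; exact: powR_ge0.
apply: (measurableT_comp (measurable_powR r)).
apply: (measurableT_comp (@normr_measurable R setT)).
apply: measurable_funD; first exact: measurable_snd.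
by apply: measurableT_comp => //; exact: measurable_fst.
Qed.

(** The term of [normD_powR_le] that is linear in the increment integrates to
    0. *)
Lemma martingale_moment_step (N : R) z : (1 <= N)%R ->
  SP mart z <= (1 + c / N)%:E * mart z +
    (c * N `^ (r / 2 - 1))%:E * incr_moment phi z.1.
Proof.
move=> N1; case: z => x s /=; have N0 : (0 < N)%R by lra.
pose A := (s + u x)%R; pose b := (c * N `^ (r / 2 - 1))%R.
have b0 : (0 < b)%R by rewrite mulr_gt0// powR_gt0.
have [->|fin] := eqVneq (incr_moment phi x) +oo.
  rewrite -/b gt0_muley ?lte_fin// addey ?leey//.
have mfx : measurable_fun setT (fun y => f y x).
  apply: (measurableT_comp df.1 (g := fun y => (x, y))).
  by apply: measurable_fun_pair => //; exact: measurable_cst.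
have f0 y : (0 <= f y x)%R by exact: df.2.
have nphi := nnmf_incr_slice x mphi.
have if1 : mu.-integrable setT (fun y => (f y x)%:E).
  apply/integrableP; split; first exact/measurable_EFinP.
  under eq_integral do rewrite gee0_abs ?lee_fin//.
  by case: tf => _ _ ->; rewrite ltry.
have if3 : mu.-integrable setT (fun y => (f y x)%:E * (`|phi y x| `^ r)%:E).
  apply/integrableP; split.
    by apply: emeasurable_funM; [exact/measurable_EFinP|case: nphi].
  under eq_integral do rewrite gee0_abs ?mule_ge0 ?lee_fin ?powR_ge0//.
  by rewrite ltey.
have int1 : mu.-integrable setT (fun y => ((1 + c / N) * `|A| `^ r)%:E * (f y x)%:E).
  exact: integrableZl.
have int2 : mu.-integrable setT
    (fun y => (r * `|A| `^ r / A)%:E * (f y x * phi y x)%:E).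
  exact: integrableZl.
have int3 : mu.-integrable setT (fun y => b%:E * ((f y x)%:E * (`|phi y x| `^ r)%:E)).
  exact: integrableZl.
have -> : SP mart (x, s) = \int[mu]_y ((f y x)%:E * (`|A + phi y x| `^ r)%:E).
  apply: eq_integral => y _; rewrite /mart /add_incr /=.
  by have -> : (s + G y x + u y = A + phi y x)%R by rewrite /A /phi; ring.
apply: (@le_trans _ _ (\int[mu]_y (
   (((1 + c / N) * `|A| `^ r)%:E * (f y x)%:E +
    (r * `|A| `^ r / A)%:E * (f y x * phi y x)%:E) +
   b%:E * ((f y x)%:E * (`|phi y x| `^ r)%:E)))).
  apply: ge0_le_integral => //.
  - by move=> y _; rewrite mule_ge0 ?lee_fin ?powR_ge0.
  - apply: emeasurable_funM; first exact/measurable_EFinP.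
    have mA : measurable_fun setT (fun z : T * T => (A + phi z.1 z.2)%R).
      by apply: measurable_funD => //; exact: measurable_cst.
    by case: (@nnmf_incr_slice (fun y x => A + phi y x)%R x mA).
  - apply: emeasurable_funD.
      by apply: emeasurable_funD; [case/integrableP: int1|case/integrableP: int2].
    by case/integrableP: int3.
  - move=> y _; rewrite -!EFinM -!EFinD lee_fin.
    have := @normD_powR_le R r A (phi y x) N c r2 N1 erefl.
    rewrite -/b => /(ler_wpM2l (f0 y)) h; apply: (le_trans h).
    by rewrite le_eqVlt; apply/orP; left; apply/eqP; ring.
rewrite integralD//; last exact: integrableD.
rewrite integralD//.
rewrite !integralZl// phi0 mule0 adde0; case: tf => _ _ ->.
by rewrite mule1.
Qed.

(** Up to a constant and one transition, this dominates the moment of the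
    martingale increments, and it no longer involves [u]. *)
Definition step_moment (x : T) : \bar R := incr_moment G x + (V x `^ r)%:E.
Local Notation L := step_moment.

Definition step_moment_sum (N : nat) (x : T) : \bar R :=
  \sum_(0 <= j < N.+1) iter j P L x.

Let nVr : nnmf (fun x => (V x `^ r)%:E).
Proof.
apply: nnmf_EFin; last by move=> x; exact: powR_ge0.
by apply: (measurableT_comp (measurable_powR r)).
Qed.

Lemma nnmf_step_moment : nnmf L.
Proof. by apply: nnmfD => //; exact: nnmf_incr_moment. Qed.
Let nL := nnmf_step_moment.

Lemma nnmf_step_moment_sum N : nnmf (step_moment_sum N).
Proof. by apply: nnmf_sum => j; exact: nnmf_iter_trans. Qed.

Let B0 : R := (2 `^ r * (1 + 2 `^ r * K `^ r))%R.
Let B00 : (0 <= B0)%R.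
Proof. by rewrite mulr_ge0 ?addr_ge0 ?mulr_ge0 ?powR_ge0. Qed.

Let ur x : (`|u x| `^ r <= K `^ r * V x `^ r)%R.
Proof.
by rewrite -powRM//; apply: ge0_ler_powR; rewrite ?nnegrE ?mulr_ge0.
Qed.

Lemma phi_moment_le x : incr_moment phi x <= B0%:E * (L x + P L x).
Proof.
have n3 : nnmf (fun y => (`|G y x| `^ r)%:E + (V y `^ r)%:E).
  by apply: nnmfD => //; exact: nnmf_incr_slice.
have n4 : nnmf (fun y => (`|G y x| `^ r)%:E + (V y `^ r)%:E + (V x `^ r)%:E).
  by apply: nnmfD => //; apply: nnmf_cst; rewrite lee_fin powR_ge0.
have n5 : nnmf (fun _ : T => (V x `^ r)%:E).
  by apply: nnmf_cst; rewrite lee_fin powR_ge0.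
have fy (h : T -> \bar R) : nnmf h -> nnmf (fun y => (f y x)%:E * h y).
  exact: (nnmf_kop_integrand df measurable_snd x).
apply: (@le_trans _ _ (\int[mu]_y ((f y x)%:E * (B0%:E *
   ((`|G y x| `^ r)%:E + (V y `^ r)%:E + (V x `^ r)%:E))))).
  apply: nn_le_integral.
  - by apply: fy; exact: nnmf_incr_slice.
  - by apply: fy; exact: nnmfZ.
  move=> y; apply: lee_wpmul2l; first by rewrite lee_fin; exact: df.2.
  rewrite -!EFinD lee_fin.
  rewrite /phi -addrA; apply: le_trans (normD_powR_le2 _ _ r0) _.
  rewrite /B0 -mulrA ler_wpM2l ?powR_ge0//.
  have h1 := normD_powR_le2 (u y) (- u x) r0; rewrite normrN in h1.
  have h2 : (2 `^ r * (`|u y| `^ r + `|u x| `^ r) <=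
             2 `^ r * K `^ r * (V y `^ r + V x `^ r))%R.
    by rewrite -mulrA ler_wpM2l ?powR_ge0// mulrDr lerD.
  have g0 : (0 <= 2 `^ r * K `^ r * `|G y x| `^ r)%R.
    by rewrite !mulr_ge0 ?powR_ge0.
  have v0 : (0 <= V y `^ r + V x `^ r)%R by rewrite addr_ge0 ?powR_ge0.
  rewrite -addrA [leRHS]mulrDl mul1r [X in (_ <= _ + X)%R]mulrDr.
  by have := le_trans h1 h2; lra.
rewrite [X in X <= _](_ : _ = B0%:E * \int[mu]_y ((f y x)%:E *
   ((`|G y x| `^ r)%:E + (V y `^ r)%:E + (V x `^ r)%:E))); last first.
  rewrite -nn_integralZ//; last exact: fy.
  by apply: eq_integral => y _; rewrite muleCA.
apply: lee_wpmul2l; first by rewrite lee_fin.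
rewrite [X in X <= _](_ : _ = incr_moment G x + P (fun y => (V y `^ r)%:E) x
    + (V x `^ r)%:E); last first.
  rewrite -[X in _ = _ + X](trans_cst tf x (powR_ge0 (V x) r)).
  rewrite /incr_moment /trans /kop/=.
  have nG : nnmf (fun y => (`|G y x| `^ r)%:E) by exact: nnmf_incr_slice.
  rewrite -nn_integralD; [|exact: fy..].
  rewrite -nn_integralD; [|by apply: nnmfD; exact: fy|exact: fy].
  apply: eq_integral => y _; rewrite ge0_muleDr ?adde_ge0 ?lee_fin ?powR_ge0//.
  by rewrite ge0_muleDr ?lee_fin ?powR_ge0.
rewrite addeAC; apply: leeD => //; apply: (kop_le mu df measurable_snd x nVr nL) => y.
by rewrite leeDr//; case: (nnmf_incr_moment mG).
Qed.

Lemma iter_step_moment_le N n x : (n <= N)%N ->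
  iter n P (fun y => (V y `^ r)%:E) x <= step_moment_sum N x.
Proof.
move=> nN; apply: (@le_trans _ _ (iter n P L x)).
  apply: (iter_kop_le mu df measurable_snd n x nVr nL) => y.
  by rewrite leeDr//; case: (nnmf_incr_moment mG).
rewrite /step_moment_sum big_mkord (bigD1 (Ordinal (nN : (n < N.+1)%N)))//=.
by rewrite leeDl// sume_ge0// => i _; case: (nnmf_iter_trans i nL).
Qed.

Lemma sum_phi_moment_le N n x : (n <= N)%N ->
  \sum_(0 <= j < n) iter j P (incr_moment phi) x <=
  (2 * B0)%:E * step_moment_sum N x.
Proof.
move=> nN; have nP := nnmf_trans nL.
have it0 j : 0 <= iter j P L x by case: (nnmf_iter_trans j nL).
apply: (@le_trans _ _
  (\sum_(0 <= j < n) B0%:E * (iter j P L x + iter j.+1 P L x))).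
  apply: lee_sum => j _; rewrite iterSr.
  rewrite -(iter_kopD mu df measurable_snd j x nL nP).
  rewrite -(iter_kopZ mu df measurable_snd j x B00 (nnmfD nL nP)).
  exact: (iter_kop_le mu df measurable_snd j x (nnmf_incr_moment mphi)
    (nnmfZ B00 (nnmfD nL nP)) phi_moment_le).
rewrite -ge0_sume_distrr; last by move=> j _; rewrite adde_ge0.
rewrite [(2 * B0)%R]mulrC [X in _ <= X * _]EFinM -muleA.
apply: lee_wpmul2l; first by rewrite lee_fin.
rewrite big_split/= -[2%R]/(1 + 1)%R EFinD ge0_muleDl// !mul1e; apply: leeD.
  apply: lee_sum_nneg_natr => //; exact: leqW.
apply: (@le_trans _ _ (\sum_(0 <= j < n.+1) iter j P L x)).
  by rewrite [leRHS]big_nat_recl// leeDr//; exact: (it0 0%N).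
by apply: lee_sum_nneg_natr.
Qed.

Definition tail_const : R :=
  (2 `^ r * (expR c * (K `^ r + c * (2 * B0)) + K `^ r))%R.

Lemma tail_const_ge0 : (0 <= tail_const)%R.
Proof.
apply: mulr_ge0; first exact: powR_ge0.
apply: addr_ge0; last exact: powR_ge0.
apply: mulr_ge0; first exact: expR_ge0.
apply: addr_ge0; first exact: powR_ge0.
by apply: mulr_ge0; [exact: ltW|exact: mulr_ge0].
Qed.

(** Markov's inequality for the moment of order [r]; over a horizon [N] the
    factor accumulated by the martingale stays below [expR c]. *)
Lemma tail_le (N n : nat) (t : R) x : (0 < N)%N -> (n <= N)%N -> (0 < t)%R ->
  iter n SP (exceeds t) (x, 0%R) <=
  (t `^ (- r) * (tail_const * N%:R `^ (r / 2 - 1)))%:E * step_moment_sum N x.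
Proof.
move=> N0 nN t0; have N1 : (1 <= N%:R :> R)%R by rewrite ler1n.
pose Np : R := (N%:R `^ (r / 2 - 1))%R.
have Np1 : (1 <= Np)%R.
  by rewrite -(powRr0 (N%:R : R)%R) ler_powR//; have := r2; lra.
have Np0 : (0 <= Np)%R by exact: le_trans Np1.
have nV := nnmf_fst nVr.
have Kr0 : (0 <= K `^ r)%R by exact: powR_ge0.
have S0 : 0 <= step_moment_sum N x by case: (nnmf_step_moment_sum N).
have nZV : nnmf (fun z : T * R => (K `^ r)%:E * (V z.1 `^ r)%:E) by exact: nnmfZ.
have nm := nnmfD nmart nZV.
have k0 : (0 <= t `^ (- r) * 2 `^ r)%R by rewrite mulr_ge0 ?powR_ge0.
apply: (@le_trans _ _ (iter n SP (fun z => (t `^ (- r) * 2 `^ r)%:E *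
   (mart z + (K `^ r)%:E * (V z.1 `^ r)%:E)) (x, 0%R))).
  apply: iter_sum_trans_le; [exact: nnmf_exceeds|exact: nnmfZ|].
  move=> [y s]; rewrite /exceeds -EFinM lee_fin indicE.
  have rhs0 : (0 <= t `^ (- r) * 2 `^ r * (`|s + u y| `^ r + K `^ r * V y `^ r))%R.
    by rewrite mulr_ge0// addr_ge0 ?mulr_ge0 ?powR_ge0.
  have [/set_mem/= ts|_] := boolP (_ \in _); last by [].
  apply: (@le_trans _ _ (t `^ (- r) * `|s| `^ r)%R).
    rewrite powRN ler_pdivlMl ?powR_gt0// mulr1.
    by rewrite ge0_ler_powR// ?nnegrE ltW.
  rewrite -mulrA ler_wpM2l ?powR_ge0//=.
  have {1}-> : s = ((s + u y) + - u y)%R by rewrite addrK.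
  apply: le_trans (normD_powR_le2 _ _ r0) _.
  by rewrite ler_wpM2l ?powR_ge0// lerD2l normrN.
rewrite iter_kopZ// iter_kopD// iter_kopZ//.
have -> : iter n (kop mu (fun y (z : T * R) => f y z.1) (add_incr G))
    (fun z => (V z.1 `^ r)%:E) (x, 0%R) = iter n P (fun y => (V y `^ r)%:E) x.
  exact: (@iter_sum_trans_fst d T R mu n f G (fun y => (V y `^ r)%:E) (x, 0%R)).
have c0' := ltW c0.
have NR0 : (0 < N%:R :> R)%R by rewrite ltr0n.
have k1 : (1 <= 1 + c / N%:R)%R by rewrite lerDl divr_ge0.
have hm := iter_sum_trans_drift nmart (nnmf_incr_moment mphi) k1
  (mulr_ge0 c0' Np0) (fun z => martingale_moment_step z N1) n (x, 0%R).
have p1 : (0 <= K `^ r * Np)%R by exact: mulr_ge0.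
have p2 : (0 <= c * Np * (2 * B0))%R.
  by apply: mulr_ge0; exact: mulr_ge0.
have p3 : (0 <= expR c * (K `^ r + c * (2 * B0)) * Np)%R.
  apply: mulr_ge0 => //; apply: mulr_ge0; first exact: expR_ge0.
  by apply: addr_ge0 => //; apply: mulr_ge0 => //; exact: mulr_ge0.
have hk : ((1 + c / N%:R) ^+ n <= expR c)%R.
  apply: (@le_trans _ _ (expR (c / N%:R) ^+ n)%R).
    apply: lerXn2r; rewrite ?nnegrE ?expR_ge0//; first exact: le_trans k1.
    exact: expR_ge1Dx.
  rewrite -expRM_natl ler_expR mulrCA ler_piMr//.
  by rewrite ler_pdivrMr// mul1r ler_nat.
have hmart : mart (x, 0%R) <= (K `^ r * Np)%:E * step_moment_sum N x.
  apply: (@le_trans _ _ ((K `^ r)%:E * (V x `^ r)%:E)).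
    by rewrite -EFinM lee_fin /= add0r.
  apply: lee_pmul; rewrite ?lee_fin ?powR_ge0//; first by rewrite ler_peMr.
  exact: (@iter_step_moment_le N 0).
have {}hm : iter n SP mart (x, 0%R) <=
    (expR c * (K `^ r + c * (2 * B0)) * Np)%:E * step_moment_sum N x.
  apply: (le_trans hm).
  apply: (@le_trans _ _ ((expR c)%:E * ((K `^ r * Np)%:E * step_moment_sum N x +
     (c * Np)%:E * ((2 * B0)%:E * step_moment_sum N x)))).
    apply: lee_pmul.
    - by rewrite lee_fin exprn_ge0// (le_trans _ k1).
    - rewrite adde_ge0//; first by case: nmart.
      rewrite mule_ge0 ?lee_fin ?mulr_ge0// sume_ge0// => j _.
      by case: (nnmf_iter_trans j (nnmf_incr_moment mphi)).
    - by rewrite lee_fin.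
    apply: leeD => //; apply: lee_wpmul2l; first by rewrite lee_fin mulr_ge0.
    exact: sum_phi_moment_le.
  rewrite [X in _ * (_ + X)]muleA -[X in _ * (_ + X * _)]EFinM.
  rewrite -[X in _ * X]ge0_muleDl ?lee_fin//.
  rewrite muleA -EFinD -EFinM lee_wpmul2r// lee_fin le_eqVlt; apply/orP; left.
  by apply/eqP; ring.
have hV : (K `^ r)%:E * iter n P (fun y => (V y `^ r)%:E) x <=
    (K `^ r * Np)%:E * step_moment_sum N x.
  apply: lee_pmul; rewrite ?lee_fin//.
  - by case: (nnmf_iter_trans n nVr).
  - by rewrite ler_peMr.
  - exact: iter_step_moment_le.
apply: (@le_trans _ _ ((t `^ (- r) * 2 `^ r)%:E *
   ((expR c * (K `^ r + c * (2 * B0)) * Np)%:E * step_moment_sum N x +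
    (K `^ r * Np)%:E * step_moment_sum N x))).
  by apply: lee_wpmul2l; [rewrite lee_fin|exact: leeD].
rewrite -[X in _ * X]ge0_muleDl ?lee_fin//.
rewrite muleA -EFinD -EFinM lee_wpmul2r// lee_fin /tail_const -/Np.
by rewrite le_eqVlt; apply/orP; left; apply/eqP; ring.
Qed.

End martingale.
End moments.

(** * Start from a law with few moments *)

Section first_regeneration.
Context (d : measure_display) (T : measurableType d) (R : realType)
  (mu : {sigma_finite_measure set T -> \bar R}) (f : T -> T -> R)
  (C : set T) (m rho D : R) (V : T -> R)
  (gd : geometric_drift mu f C m rho D V)
  (lambda : probability T R)
  (lambda_inv : forall B, measurable B ->
    lambda B = \int[lambda]_x \int[mu]_(y in B) (f y x)%:E)
  (G : T -> T -> R) (mG : measurable_fun setT (fun z : T * T => G z.1 z.2))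
  (B : R) (B0 : (0 <= B)%R)
  (GV : forall x, \int[mu]_y ((f y x)%:E * (`|G y x|)%:E) <= (B * V x)%:E)
  (eps : R) (eps0 : (0 < eps)%R).

Let tf := gd_density gd.
Let df := transition_kernel tf.
Let dS := sum_kernel df.
Let mS := measurable_add_incr mG.
Let mC := gd_measurable_set gd.
Let m0 := gd_minor_gt0 gd.
Let V1 := gd_ge1 gd.
Let delta := regen_mass mu C m.
Let delta0 : (0 < delta)%R.
Proof. exact: (regen_mass_gt0 gd lambda_inv). Qed.
Local Notation P := (trans mu f).
Local Notation SP := (sum_trans mu f G).
Local Notation Q := (trans mu (residual f C m)).
Local Notation rg := (regen mu C m).
Local Notation W := (potential mu C m rho D V).

(** Expected number of indices [n] in [[j, j + i[] at which the sum, equal to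
    [z.2] at time [j], exceeds [eps * n]. *)
Definition tails (j i : nat) (z : T * R) : \bar R :=
  \sum_(0 <= l < i) iter l SP (exceeds (eps * (j + l)%:R)) z.

(** Half of each threshold is reserved for the value of the sum at time [j]. *)
Definition half_tails (j i : nat) (y : T) : \bar R :=
  \sum_(0 <= l < i) iter l SP (exceeds (eps / 2 * (j + l)%:R)) (y, 0%R).

Lemma nnmf_tails j i : nnmf (tails j i).
Proof.
apply: nnmf_sum => l; apply: nnmf_iter_sum_trans => //; exact: nnmf_exceeds.
Qed.

Lemma nnmf_half_tails j i : nnmf (half_tails j i).
Proof.
by apply: nnmf_sum => l; apply: nnmf_sum_start => //; exact: nnmf_exceeds.
Qed.

Lemma tails_recl j i z :
  tails j i.+1 z = exceeds (eps * j%:R) z + SP (tails j.+1 i) z.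
Proof.
rewrite /tails big_nat_recl//= addn0; congr (_ + _).
rewrite /sum_trans kop_sum//; last first.
  by move=> l; apply: nnmf_iter_sum_trans => //; exact: nnmf_exceeds.
by apply: eq_bigr => l _; rewrite addnS.
Qed.

Lemma iter_sum_trans_cst n (c : R) z : (0 <= c)%R -> iter n SP (cst c%:E) z = c%:E.
Proof.
move=> c0; elim: n z => //= n IH z.
rewrite -[RHS](trans_cst tf z.1 c0) /sum_trans /trans /kop.
by apply: eq_integral => y _; rewrite IH.
Qed.

Lemma count_lt (a : R) (i : nat) : (0 <= a)%R ->
  (\sum_(0 <= l < i) (l.+1%:R < a)%R%:R <= a :> R)%R.
Proof.
move=> a0; suff [] : (\sum_(0 <= l < i) (l.+1%:R < a)%R%:R <= a :> R)%R /\
  (\sum_(0 <= l < i) (l.+1%:R < a)%R%:R <= i%:R :> R)%R by [].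
elim: i => [|i [IH1 IH2]]; first by rewrite big_nil.
rewrite big_nat_recr//=; have [h|h] := ltP i.+1%:R a; last first.
  by rewrite addr0; split=> //; apply: le_trans IH2 _; rewrite ler_nat.
have : (\sum_(0 <= l < i) (l.+1%:R < a)%R%:R + 1 <= i.+1%:R :> R)%R.
  by rewrite -natr1 lerD2r.
by move=> h'; split=> //; apply: le_trans h' _; exact: ltW.
Qed.

Lemma exceeds_shift l t y s :
  iter l SP (exceeds t) (y, s) <=
  (t / 2 < `|s|)%R%:R%:E + iter l SP (exceeds (t / 2)) (y, 0%R).
Proof.
have -> : iter l SP (exceeds t) (y, s) =
    iter l SP (fun z => exceeds t (z.1, (z.2 + s)%R)) (y, 0%R).
  by rewrite -iter_sum_trans_shift add0r.
have nc : nnmf (cst ((t / 2 < `|s|)%R%:R : R)%:E : T * R -> \bar R).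
  by apply: nnmf_cst; rewrite lee_fin.
rewrite -(iter_sum_trans_cst l (y, 0%R) (ler0n _ _)).
rewrite /sum_trans -iter_kopD//; last exact: nnmf_exceeds.
apply: iter_kop_le => //.
- apply: (nnmf_comp _ (nnmf_exceeds T t) (th := fun z : T * R => (z.1, (z.2 + s)%R))).
  apply: measurable_fun_pair; first exact: measurable_fst.
  by apply: measurable_funD; [exact: measurable_snd|exact: measurable_cst].
- by apply: nnmfD => //; exact: nnmf_exceeds.
move=> [y' s'] /=; rewrite /exceeds -EFinD lee_fin !indicE.
have [/set_mem/= h|_] := boolP (_ \in _); last by rewrite addr_ge0.
have [_|h1] := ltP (t / 2)%R `|s|%R; first by rewrite lerDl.
rewrite mem_set//= ?add0r//.
by have := ler_normD s' s; lra.
Qed.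

(** Either the value of the sum at time [j] exceeds half of the threshold, for a
    number of indices bounded by its size, or the later increments do. *)
Lemma tails_le_half j i y s :
  tails j.+1 i (y, s) <= (2 / eps * `|s|)%:E + half_tails j.+1 i y.
Proof.
apply: (@le_trans _ _ (\sum_(0 <= l < i) ((l.+1%:R < 2 / eps * `|s|)%R%:R%:E +
    iter l SP (exceeds (eps / 2 * (j.+1 + l)%:R)) (y, 0%R)))).
  apply: lee_sum => l _.
  have -> : (eps / 2 * (j.+1 + l)%:R = eps * (j.+1 + l)%:R / 2)%R by rewrite mulrAC.
  apply: le_trans (exceeds_shift _ _ _ _) _; rewrite leeD2r// lee_fin.
  have [h|h] := ltP (eps * (j.+1 + l)%:R / 2)%R `|s|%R; last by [].
  rewrite (_ : (_ < _)%R = true)//; apply/(@le_lt_trans _ _ (j.+1 + l)%:R).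
    by rewrite ler_nat addSn ltnS leq_addl.
  rewrite -ltr_pdivrMl ?divr_gt0//.
  by apply: le_lt_trans h; rewrite le_eqVlt; apply/orP; left; apply/eqP; field; rewrite gt_eqF.
rewrite big_split/=; apply: leeD => //.
rewrite sumEFin lee_fin; apply: count_lt.
by rewrite mulr_ge0// divr_ge0// ltW.
Qed.

Context (Kap : R) (Kap0 : (0 <= Kap)%R)
  (regen_tails : forall j i, rg (half_tails j.+1 i) <= (Kap * delta)%:E).

Definition tails_bound (z : T * R) : R :=
  (2 / eps * `|z.2| + (1 + 2 / eps * B) * W z.1 + Kap)%R.

(** Up to the first regeneration the indices are counted by the time spent and
    by the size of the sum, both controlled by the potential [W]; from then on
    by [Kap]. The induction performs this split one step at a time. *)
Lemma tails_le j i z : tails j i z <= (tails_bound z)%:E.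
Proof.
have e0 : (0 <= 2 / eps)%R by rewrite divr_ge0// ltW.
pose c1 : R := (1 + 2 / eps * B)%R.
have c10 : (0 <= c1)%R by rewrite addr_ge0// mulr_ge0.
have W0 x : (0 <= W x)%R by exact: (potential_ge0 gd lambda_inv).
have nW : nnmf (EFin \o W) by exact: (nnmf_potential gd lambda_inv).
have dQ : kernel_density (residual f C m) := residual_kernel tf mC (gd_minor gd).
elim: i j z => [|i IH] j [x s].
  rewrite /tails big_nil lee_fin /tails_bound.
  by rewrite addr_ge0// addr_ge0// mulr_ge0.
rewrite tails_recl /sum_trans /kop /add_incr/=.
pose h1 y : \bar R := (2 / eps)%:E * (`|s + G y x|)%:E.
pose h2 y : \bar R := c1%:E * (W y)%:E + Kap%:E.
have mGx : measurable_fun setT (fun y => G y x).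
  apply: (measurableT_comp mG (g := fun y => (y, x))).
  by apply: measurable_fun_pair => //; exact: measurable_cst.
have nG : nnmf (fun y => (`|G y x|)%:E).
  apply: nnmf_EFin => //.
  by apply: (measurableT_comp (@normr_measurable R setT)).
have nsG : nnmf (fun y => (`|s + G y x|)%:E).
  apply: nnmf_EFin => //; apply: (measurableT_comp (@normr_measurable R setT)).
  by apply: measurable_funD => //; exact: measurable_cst.
have n1 : nnmf h1 by exact: nnmfZ.
have nK : nnmf (cst Kap%:E : T -> \bar R) by apply: nnmf_cst; rewrite lee_fin.
have ncW : nnmf (fun y => c1%:E * (W y)%:E) by exact: nnmfZ.
have n2 : nnmf h2 by exact: nnmfD.
have nF : nnmf (fun y => tails j.+1 i (y, (s + G y x)%R)).
  apply: (nnmf_comp _ (nnmf_tails j.+1 i) (th := fun y => (y, (s + G y x)%R))).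
  apply: measurable_fun_pair => //.
  by apply: measurable_funD => //; exact: measurable_cst.
have nht := nnmf_half_tails j.+1 i.
rewrite (regen_split tf mC m0 (gd_minor gd) x nF).
have le1 : \int[mu]_y ((residual f C m y x)%:E * tails j.+1 i (y, (s + G y x)%R))
    <= Q h1 x + (c1%:E * Q (EFin \o W) x + Kap%:E * Q (cst 1) x).
  have n11 : nnmf (cst 1 : T -> \bar R) by exact: nnmf_cst.
  rewrite /trans -(kopZ mu dQ measurable_snd x c10 nW).
  rewrite -(kopZ mu dQ measurable_snd x Kap0 n11).
  rewrite -(kopD mu dQ measurable_snd x ncW (nnmfZ Kap0 n11)).
  rewrite -(kopD mu dQ measurable_snd x n1 (nnmfD ncW (nnmfZ Kap0 n11))).
  apply: nn_le_integral.
  - exact: (nnmf_kop_integrand dQ measurable_snd x nF).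
  - exact: (nnmf_kop_integrand dQ measurable_snd x
      (nnmfD n1 (nnmfD ncW (nnmfZ Kap0 n11)))).
  move=> y; apply: lee_wpmul2l; first by rewrite lee_fin; exact: dQ.2.
  apply: (le_trans (IH _ _)); rewrite /h1 /tails_bound /= mule1 -!EFinM -!EFinD.
  by rewrite lee_fin addrA.
have le2 : rg (fun y => tails j.+1 i (y, (s + G y x)%R)) <=
    rg h1 + (Kap * delta)%:E.
  apply: (@le_trans _ _ (rg h1 + rg (half_tails j.+1 i))).
    rewrite -(regenD mu mC m0 n1 nht).
    apply: (regen_le mu mC m0 nF (nnmfD n1 nht)) => y.
    exact: tails_le_half.
  by rewrite leeD2l.
have le3 : Q h1 x + (\1_C x)%:E * rg h1 <= (2 / eps * `|s| + 2 / eps * B * V x)%:E.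
  rewrite -(trans_split tf mC m0 (gd_minor gd) x n1).
  rewrite [X in X <= _](_ : _ = (2 / eps)%:E * P (fun y => (`|s + G y x|)%:E) x);
    last exact: kopZ.
  have -> : (2 / eps * `|s| + 2 / eps * B * V x = 2 / eps * (`|s| + B * V x))%R.
    by rewrite mulrDr mulrA.
  rewrite [leRHS]EFinM; apply: lee_wpmul2l; first by rewrite lee_fin.
  apply: (@le_trans _ _ (P (fun y => (cst (`|s|)%:E) y + (`|G y x|)%:E) x)).
    apply: (kop_le mu df measurable_snd x nsG).
      by apply: nnmfD => //; apply: nnmf_cst; rewrite lee_fin.
    by move=> y; rewrite -EFinD lee_fin ler_normD.
  rewrite [X in X <= _](_ : _ = P (cst (`|s|)%:E) x + P (fun y => (`|G y x|)%:E) x);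
    last first.
    apply: (kopD mu df measurable_snd x _ nG).
    by apply: nnmf_cst; rewrite lee_fin.
  by rewrite trans_cst// EFinD leeD2l//; exact: GV.
have Q1 : Q (cst 1) x = (1 - delta * \1_C x)%:E.
  exact: (residual_cst tf mC (gd_finite gd) m0 (gd_minor gd)).
have pd := potential_decrease gd lambda_inv x.
have QW0 : 0 <= Q (EFin \o W) x.
  by have [_ h] := nnmf_kop mu dQ measurable_snd nW; exact: h.
have {pd} : Q (EFin \o W) x <= (W x - V x)%:E.
  by rewrite EFinB leeBrDl.
have C0 : (0 <= \1_C x :> R)%R by rewrite indicE.
have h10 : 0 <= rg h1 by exact: regen_ge0.
move=> pd; apply: (@le_trans _ _ (1 +
   ((Q h1 x + (c1%:E * (W x - V x)%:E + Kap%:E * (1 - delta * \1_C x)%:E)) +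
    (\1_C x)%:E * (rg h1 + (Kap * delta)%:E)))).
  apply: leeD.
    by rewrite /exceeds lee_fin indicE; case: (_ \in _).
  apply: leeD; last exact: lee_wpmul2l.
  apply: (le_trans le1); rewrite leeD2l// Q1 leeD2r//.
  by apply: lee_wpmul2l; rewrite ?lee_fin.
have -> : 1 + ((Q h1 x + (c1%:E * (W x - V x)%:E + Kap%:E * (1 - delta * \1_C x)%:E)) +
    (\1_C x)%:E * (rg h1 + (Kap * delta)%:E)) =
  (Q h1 x + (\1_C x)%:E * rg h1) + (1 + c1 * (W x - V x) + Kap)%:E.
  rewrite ge0_muleDr//; last by rewrite lee_fin mulr_ge0// ltW.
  rewrite [X in 1 + X]addeACA [LHS]addeCA; congr (_ + _).
  transitivity ((1 + (c1 * (W x - V x) + Kap * (1 - delta * \1_C x) +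
    \1_C x * (Kap * delta)))%R%:E) => //.
  by congr EFin; ring.
apply: (le_trans (leeD2r _ le3)); rewrite -EFinD lee_fin /tails_bound /= -/c1.
have := V1 x; rewrite /c1 => Vx.
have : (0 <= 2 / eps * B * (V x - 1))%R.
  by apply: mulr_ge0; [exact: mulr_ge0|rewrite subr_ge0].
by lra.
Qed.

End first_regeneration.

(** * Moments of the regenerated chain *)

Section regenerated_moments.
Context (d : measure_display) (T : measurableType d) (R : realType)
  (mu : {sigma_finite_measure set T -> \bar R}) (f : T -> T -> R)
  (C : set T) (m rho D : R) (V : T -> R)
  (gd : geometric_drift mu f C m rho D V).

Let tf := gd_density gd.
Let df := transition_kernel tf.
Let mC := gd_measurable_set gd.
Let m0 := gd_minor_gt0 gd.
Let V1 := gd_ge1 gd.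
Let V0 x : (0 <= V x)%R. Proof. exact: le_trans (V1 x). Qed.
Let nV : nnmf (EFin \o V).
Proof. exact: nnmf_EFin (gd_measurable gd) V0. Qed.
Let nC : nnmf (fun x => (\1_C x)%:E : \bar R). Proof. exact: nnmf_indic. Qed.
Local Notation P := (trans mu f).
Local Notation rg := (regen mu C m).

(** Since [V] is at least 1, a step from outside [C] lowers its expected value
    by at least [rho]. *)
Lemma drift_visits n x :
  (rho * n%:R)%:E + iter n P (EFin \o V) x <=
  (V x)%:E + D%:E * \sum_(0 <= j < n) iter j P (fun y => (\1_C y)%:E) x.
Proof.
have /andP[r0 r1] := gd_rate gd.
have D0 := ltW (gd_const_gt0 gd).
elim: n => [|n IH]; first by rewrite mulr0 add0e big_nil mule0 adde0.
have c0 : nnmf (cst rho%:E : T -> \bar R) by apply: nnmf_cst; rewrite lee_fin ltW.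
have nPV : nnmf (P (EFin \o V)) by exact: nnmf_trans.
have nDC : nnmf (fun y => D%:E * (\1_C y)%:E : \bar R) by exact: nnmfZ.
have cstE : iter n P (cst rho%:E) x = rho%:E.
  elim: n x {IH} => //= n IH x; rewrite -[RHS](trans_cst tf x (ltW r0)).
  by congr (P _ _); apply/funext => y; rewrite IH.
have step : rho%:E + iter n.+1 P (EFin \o V) x <=
    iter n P (EFin \o V) x + D%:E * iter n P (fun y => (\1_C y)%:E) x.
  rewrite -[X in X + _]cstE iterSr.
  rewrite -(iter_kopD mu df measurable_snd n x c0 nPV).
  rewrite -(iter_kopZ mu df measurable_snd n x D0 nC).
  rewrite -(iter_kopD mu df measurable_snd n x nV nDC).
  apply: (iter_kop_le mu df measurable_snd n x (nnmfD c0 nPV) (nnmfD nV nDC)).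
  move=> y; apply: (@le_trans _ _ (rho%:E + ((1 - rho) * V y + D * \1_C y)%:E)).
    by rewrite leeD2l//; exact: (gd_drift gd).
  rewrite /= -!EFinM -!EFinD lee_fin.
  have : (0 <= rho * (V y - 1))%R by rewrite mulr_ge0 ?subr_ge0 ?V1// ltW.
  by lra.
have s0 : 0 <= \sum_(0 <= j < n) iter j P (fun y => (\1_C y)%:E) x.
  by apply: sume_ge0 => j _; case: (nnmf_iter_trans tf j nC).
have i0 : 0 <= iter n P (fun y => (\1_C y)%:E) x.
  by case: (nnmf_iter_trans tf n nC).
rewrite big_nat_recr// ge0_muleDr// [leRHS]addeA.
have aux (a b c e : \bar R) : b + c <= e -> a + b + c <= a + e.
  by move=> h; rewrite -addeA leeD2l.
apply: (@le_trans _ _ ((rho * n%:R)%:E + (iter n P (EFin \o V) x +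
   D%:E * iter n P (fun y => (\1_C y)%:E) x))).
  have -> : (rho * n.+1%:R)%:E = (rho * n%:R)%:E + rho%:E.
    by rewrite -EFinD -natr1 mulrDr mulr1.
  exact: (aux _ _ _ _ step).
by rewrite [leLHS]addeA leeD2r.
Qed.

Lemma regen_iter_le (h : T -> \bar R) n x : nnmf h ->
  (\1_C x)%:E * rg (iter n P h) <= iter n.+1 P h x.
Proof.
move=> nh; have nPh := nnmf_iter_trans tf n nh.
rewrite [leRHS](trans_split tf mC m0 (gd_minor gd) x nPh) leeDr//.
have [_ h0] := nnmf_kop mu (residual_kernel tf mC (gd_minor gd)) measurable_snd nPh.
exact: h0.
Qed.

Context (d' : measure_display) (Om : measurableType d') (Pr : probability Om R)
  (Y : {mfun Om >-> T}) (VY : \int[Pr]_w (V (Y w))%:E < +oo).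

Let nY (h : T -> \bar R) : nnmf h -> nnmf (fun w => h (Y w)).
Proof. exact: nnmf_comp. Qed.

(** Without visits to [C] the expected value of [V] would become negative. *)
Lemma exists_visit :
  exists j, 0 < \int[Pr]_w iter j P (fun y => (\1_C y)%:E) (Y w).
Proof.
apply: contrapT => /forallNP nvis.
have vis0 j : \int[Pr]_w iter j P (fun y => (\1_C y)%:E) (Y w) = 0.
  apply/eqP; rewrite eq_le; apply/andP; split; first by rewrite leNgt; exact/negP.
  exact: nn_integral_ge0 (nY (nnmf_iter_trans tf j nC)).
have /andP[r0 r1] := gd_rate gd.
have D0 := ltW (gd_const_gt0 gd).
have bound n : (rho * n%:R)%:E <= \int[Pr]_w (V (Y w))%:E.
  have ns : nnmf (fun x => \sum_(0 <= j < n) iter j P (fun y => (\1_C y)%:E) x).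
    by apply: nnmf_sum => j; exact: nnmf_iter_trans.
  have nr : (0 <= rho * n%:R)%R by rewrite mulr_ge0// ltW.
  apply: (@le_trans _ _ (\int[Pr]_w (cst (rho * n%:R)%:E w))).
    by rewrite integral_cst//= [X in _ * X]probability_setT mule1.
  apply: (@le_trans _ _ (\int[Pr]_w ((V (Y w))%:E + D%:E *
     \sum_(0 <= j < n) iter j P (fun y => (\1_C y)%:E) (Y w)))).
    apply: nn_le_integral.
    - by apply: nnmf_cst; rewrite lee_fin.
    - exact: nY (nnmfD nV (nnmfZ D0 ns)).
    move=> w; apply: le_trans (drift_visits n (Y w)).
    by rewrite leeDl//; case: (nnmf_iter_trans tf n nV).
  rewrite (nn_integralD _ (nY nV) (nY (nnmfZ D0 ns))).
  rewrite (nn_integralZ _ D0 (nY ns)).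
  rewrite nn_integral_sum; last by move=> j; exact: nY (nnmf_iter_trans tf j nC).
  by rewrite big1 ?mule0 ?adde0.
have Vfin : \int[Pr]_w (V (Y w))%:E \is a fin_num.
  by rewrite ge0_fin_numE//; exact: nn_integral_ge0 (nY nV).
set v := fine (\int[Pr]_w (V (Y w))%:E).
have v0 : (0 <= v / rho)%R.
  by rewrite divr_ge0 ?(ltW r0)// fine_ge0//; exact: nn_integral_ge0 (nY nV).
have := bound (Num.bound (v / rho)); rewrite -(fineK Vfin) -/v lee_fin.
rewrite mulrC -ler_pdivlMr// leNgt; move/negP; apply.
exact: archi_boundP.
Qed.

(** A bound valid for the law of [Y] passes to the regeneration law, because
    with positive probability the chain started at [Y] visits [C]. *)
Lemma regen_moment (h : T -> \bar R) (M : R) : nnmf h ->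
  (forall n, \int[Pr]_w iter n P h (Y w) <= M%:E) ->
  exists M' : R, (0 <= M')%R /\ forall n, rg (iter n P h) <= M'%:E.
Proof.
move=> nh hM; have [j pj] := exists_visit.
set p := \int[Pr]_w iter j P (fun y => (\1_C y)%:E) (Y w) in pj.
have nPC := nnmf_iter_trans tf j nC.
have key (s : R) n : (0 <= s)%R -> s%:E <= rg (iter n P h) -> s%:E * p <= M%:E.
  move=> s0 sr; apply: le_trans (hM (j + n.+1)%N).
  rewrite /p -(nn_integralZ _ s0 (nY nPC)); apply: nn_le_integral.
  - exact: nY (nnmfZ s0 nPC).
  - exact: nY (nnmf_iter_trans tf _ nh).
  move=> w; rewrite iterD -(iter_kopZ mu df measurable_snd j (Y w) s0 nC).
  apply: (iter_kop_le mu df measurable_snd j (Y w) (nnmfZ s0 nC)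
    (nnmf_iter_trans tf n.+1 nh)) => y.
  apply: le_trans (regen_iter_le n y nh); rewrite muleC.
  by apply: lee_wpmul2l => //; case: nC.
have M0 : (0 <= M)%R.
  rewrite -lee_fin; apply: le_trans (hM 0%N); exact: nn_integral_ge0 (nY nh).
have [q [q0 qp]] : exists q : R, (0 < q)%R /\ q%:E <= p.
  case: p pj {key} => [q q0|_|//]; first by exists q.
  by exists 1%R; rewrite leey.
have keyq (s : R) n : (0 <= s)%R -> s%:E <= rg (iter n P h) -> (s <= M / q)%R.
  move=> s0 /(key _ _ s0) sM; rewrite ler_pdivlMr// -lee_fin EFinM.
  by apply: le_trans sM; apply: lee_wpmul2l; rewrite ?lee_fin.
exists (M / q)%R; split; first by rewrite divr_ge0// ltW.
move=> n; have rg0 : 0 <= rg (iter n P h) by exact: regen_ge0 (nnmf_iter_trans tf n nh).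
case E : (rg (iter n P h)) rg0 => [s| |//] s0.
  by rewrite lee_fin; apply: (keyq s n) => //; rewrite E.
have M1 : (0 <= M / q + 1)%R by rewrite addr_ge0// divr_ge0// ltW.
have h1 : (M / q + 1)%:E <= rg (iter n P h) by rewrite E leey.
have h2 := keyq _ n M1 h1.
have h3 : (M / q < M / q + 1)%R by rewrite ltrDl.
by move: h2; rewrite leNgt h3.
Qed.

End regenerated_moments.

(** * The log-likelihood ratio *)

Section llr.
Context (d : measure_display) (T : measurableType d) (R : realType)
  (mu : {sigma_finite_measure set T -> \bar R}) (f0 f1 : T -> T -> R)
  (t0 : transition_density mu f0) (t1 : transition_density mu f1)
  (f01 : forall x y, f0 y x = 0%R <-> f1 y x = 0%R).

Let g := llr f0 f1.
Let f0_ge0 y x : (0 <= f0 y x)%R. Proof. by case: t0. Qed.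
Let f1_ge0 y x : (0 <= f1 y x)%R. Proof. by case: t1. Qed.

(** Where both densities vanish, both sides are 0 because [ln 0 = 0]. *)
Lemma llrE y x : g y x = (ln (f1 y x) - ln (f0 y x))%R.
Proof.
rewrite /g /llr; have [h|h] := eqVneq (f1 y x) 0%R.
  by rewrite h (proj2 (f01 x y) h) mul0r subrr ln0.
have h0 : f0 y x != 0%R by apply: contra_neq h; exact: (proj1 (f01 x y)).
by rewrite ln_div// posrE lt_neqAle eq_sym ?h ?h0/=.
Qed.

Lemma measurable_llr : measurable_fun setT (fun z : T * T => g z.1 z.2).
Proof.
under [X in measurable_fun _ X]eq_fun do rewrite llrE.
apply: measurable_funB.
- by apply: (measurableT_comp (@measurable_ln R)); case: t1.
- by apply: (measurableT_comp (@measurable_ln R)); case: t0.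
Qed.

(** This is [ln t <= t - 1] for [t = f0 y x / f1 y x]. *)
Lemma llr_ge y x : (f1 y x - f0 y x <= g y x * f1 y x)%R.
Proof.
have [h|h] := eqVneq (f1 y x) 0%R.
  by rewrite h (proj2 (f01 x y) h) mulr0 subrr.
have h0 : f0 y x != 0%R by apply: contra_neq h; exact: (proj1 (f01 x y)).
have p1 : (0 < f1 y x)%R by rewrite lt_neqAle eq_sym h f1_ge0.
have p0 : (0 < f0 y x)%R by rewrite lt_neqAle eq_sym h0 f0_ge0.
have q : (0 < f0 y x / f1 y x)%R by rewrite divr_gt0.
have -> : g y x = (- ln (f0 y x / f1 y x))%R.
  by rewrite llrE ln_div ?posrE// opprB.
have : (ln (f0 y x / f1 y x) <= f0 y x / f1 y x - 1)%R.
  have {1}-> : (f0 y x / f1 y x = 1 + (f0 y x / f1 y x - 1))%R by rewrite addrC subrK.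
  by apply: le_ln1Dx; rewrite ltrBDr addrC subrr.
move=> /(ler_wpM2r (f1_ge0 y x)); rewrite mulrBl divfK// mul1r mulNr.
by lra.
Qed.

(** The negative part of the ratio, weighted by [f1], is at most [f0]. *)
Lemma norm_llr_le y x : (f1 y x * `|g y x| <= g y x * f1 y x + 2 * f0 y x)%R.
Proof.
have := llr_ge y x; have := f0_ge0 y x; have := f1_ge0 y x.
rewrite [(f1 y x * _)%R]mulrC.
by have [_|_] := ger0P (g y x) => a b c; lra.
Qed.

Context (Hgt : forall x, mu.-integrable setT (fun y => (g y x * f1 y x)%:E)).

Lemma gtildeE x : \int[mu]_y (g y x * f1 y x)%:E = (gtilde mu g f1 x)%:E.
Proof. by rewrite /gtilde /Rintegral fineK//; apply: integrable_fin_num. Qed.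

Let int_density (f : T -> T -> R) x : transition_density mu f ->
  mu.-integrable setT (fun y => (f y x)%:E).
Proof.
move=> t; have [mf fg fi] := t; apply/integrableP; split.
  apply/measurable_EFinP; apply: (measurableT_comp mf (g := fun y => (y, x))).
  by apply: measurable_fun_pair => //; exact: measurable_cst.
by under eq_integral do rewrite gee0_abs ?lee_fin//; rewrite fi ltry.
Qed.

(** The mean of the log-likelihood ratio is a Kullback--Leibler divergence. *)
Lemma gtilde_ge0 x : (0 <= gtilde mu g f1 x)%R.
Proof.
rewrite -lee_fin -gtildeE.
apply: (@le_trans _ _ (\int[mu]_y ((f1 y x)%:E - (f0 y x)%:E))).
  rewrite integralB//; [|exact: int_density..].
  by case: t1 => _ _ ->; case: t0 => _ _ ->; rewrite subee.
apply: le_integral => //.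
- by apply: integrableB => //; exact: int_density.
- by move=> y _; rewrite -EFinB lee_fin; exact: llr_ge.
Qed.

Lemma norm_llr_integral x :
  \int[mu]_y ((f1 y x)%:E * (`|g y x|)%:E) <= (gtilde mu g f1 x + 2)%:E.
Proof.
have mgx : measurable_fun setT (fun y => g y x).
  apply: (measurableT_comp measurable_llr (g := fun y => (y, x))).
  by apply: measurable_fun_pair => //; exact: measurable_cst.
apply: (@le_trans _ _ (\int[mu]_y ((g y x * f1 y x)%:E + 2%:E * (f0 y x)%:E))).
  apply: ge0_le_integral => //.
  - by move=> y _; rewrite mule_ge0 ?lee_fin.
  - apply: emeasurable_funM; first by case/integrableP: (int_density x t1).
    by apply/measurable_EFinP; apply: (measurableT_comp (@normr_measurable R setT)).
  - apply: emeasurable_funD; first by case/integrableP: (Hgt x).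
    by apply: measurable_funeM; case/integrableP: (int_density x t0).
  - by move=> y _; rewrite -!EFinM -EFinD lee_fin norm_llr_le.
rewrite integralD//; last by apply: integrableZl => //; exact: int_density.
rewrite integralZl//; last exact: int_density.
by rewrite gtildeE; case: t0 => _ _ ->; rewrite mule1 EFinD.
Qed.

End llr.

(** * Rate of convergence of the normalized sums *)

Lemma rate_le (R : realType) (r eps : R) (N : nat) : (0 < N)%N -> (0 < eps)%R ->
  ((eps * N%:R) `^ (- r) * N%:R `^ (r / 2 - 1) * N.+1%:R <=
   2 * eps `^ (- r) * N%:R `^ (- (r / 2)))%R.
Proof.
move=> N0 e0; have n0 : (0 < N%:R :> R)%R by rewrite ltr0n.
have nn : (N%:R != 0 :> R)%R by rewrite gt_eqF.
have cE : (N%:R `^ (- r) * N%:R `^ (r / 2 - 1) * N%:R = N%:R `^ (- (r / 2)) :> R)%R.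
  rewrite -[X in (_ * X = _)%R]powRr1 ?ltW// -!powRD ?nn ?implybT//.
  by congr (_ `^ _)%R; lra.
rewrite powRM ?(ltW e0) ?(ltW n0)// -cE.
set e := (eps `^ (- r))%R; set a := (N%:R `^ (- r))%R.
set b := (N%:R `^ (r / 2 - 1))%R.
have -> : (2 * e * (a * b * N%:R) = e * a * b * (2 * N%:R))%R by ring.
apply: ler_wpM2l; first by rewrite !mulr_ge0// powR_ge0.
by rewrite -natr1 mulrDl mul1r lerD2l ler1n.
Qed.

Section rate.
Context (d : measure_display) (T : measurableType d) (R : realType)
  (mu : {sigma_finite_measure set T -> \bar R}) (f : T -> T -> R)
  (C : set T) (m rho D : R) (V : T -> R)
  (gd : geometric_drift mu f C m rho D V)
  (lambda : probability T R)
  (lambda_inv : forall B, measurable B ->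
    lambda B = \int[lambda]_x \int[mu]_(y in B) (f y x)%:E)
  (g : T -> T -> R) (mg : measurable_fun setT (fun z : T * T => g z.1 z.2))
  (ig : forall x, mu.-integrable setT (fun y => (g y x * f y x)%:E))
  (gt : T -> R) (mgt : measurable_fun setT gt)
  (gtE : forall x, \int[mu]_y (g y x * f y x)%:E = (gt x)%:E)
  (gtV : forall x, (0 <= gt x <= V x)%R)
  (B : R) (B0 : (0 <= B)%R)
  (gB : forall x, \int[mu]_y ((f y x)%:E * (`|g y x|)%:E) <= (B * V x)%:E)
  (r : R) (r2 : (2 < r)%R).

Let tf := gd_density gd.
Let df := transition_kernel tf.
Let V1 := gd_ge1 gd.
Let V0 x : (0 <= V x)%R. Proof. exact: le_trans (V1 x). Qed.
Let mV := gd_measurable gd.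

Let I : R := fine (\int[lambda]_x (gt x)%:E).

Definition centred (y x : T) : R := (g y x - I)%R.
Local Notation G := centred.

Lemma measurable_centred : measurable_fun setT (fun z : T * T => G z.1 z.2).
Proof. by apply: measurable_funB => //; exact: measurable_cst. Qed.
Let mG := measurable_centred.

Local Notation P := (trans mu f).
Local Notation SP := (sum_trans mu f G).
Local Notation L := (step_moment mu f G V r).
Local Notation rg := (regen mu C m).

Let mfx x : measurable_fun setT (fun y => f y x).
Proof.
apply: (measurableT_comp df.1 (g := fun y => (x, y))).
by apply: measurable_fun_pair => //; exact: measurable_cst.
Qed.

Let int_f x : mu.-integrable setT (fun y => (f y x)%:E).
Proof.
apply/integrableP; split; first exact/measurable_EFinP.
under eq_integral do rewrite gee0_abs ?lee_fin ?df.2//.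
by case: tf => _ _ ->; rewrite ltry.
Qed.

(** The function [u] of the tail bound is a solution of the Poisson equation. *)
Lemma tail_rate : exists K : R, (0 <= K)%R /\
  forall N n (t : R) x, (0 < N)%N -> (n <= N)%N -> (0 < t)%R ->
  iter n SP (exceeds t) (x, 0%R) <=
  (t `^ (- r) * (K * N%:R `^ (r / 2 - 1)))%:E *
  step_moment_sum mu f G V r N x.
Proof.
have [u [K [meas_u uV iu uE]]] := poisson_solution gd lambda_inv mgt gtV.
exists (tail_const K r); split; first exact: tail_const_ge0.
have phiE x : (fun y => (f y x * (G y x + u y - u x))%:E) =
    (fun y => ((g y x * f y x)%:E + (f y x * u y)%:E) - (I + u x)%:E * (f y x)%:E).
  by apply/funext => y; rewrite /centred; congr EFin; ring.
have ic x : mu.-integrable setT (fun y => (I + u x)%:E * (f y x)%:E).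
  by apply: integrableZl => //; exact: int_f.
move=> N n t x; apply: (tail_le tf mG mV V1 meas_u uV r2) => {}x.
- by rewrite phiE; apply: integrableB => //; exact: integrableD.
- rewrite phiE integralB//; last exact: integrableD.
  rewrite integralD// integralZl//.
  rewrite gtE uE; case: tf => _ _ ->.
  by rewrite mule1 -!EFinD; congr EFin; rewrite -/I; ring.
Qed.

Let nL : nnmf L.
Proof. by apply: nnmf_step_moment. Qed.

(** The tail bound integrated against a law, or against the regeneration
    measure: only monotonicity and linearity of the integral matter. *)
Lemma functional_rate : exists K : R, (0 <= K)%R /\
  forall (J : (T -> \bar R) -> \bar R) (M : R),
  (forall h h', nnmf h -> nnmf h' -> (forall x, h x <= h' x) -> J h <= J h') ->
  (forall c h, (0 <= c)%R -> nnmf h -> J (fun x => c%:E * h x) = c%:E * J h) ->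
  (forall (s : seq nat) (h : nat -> T -> \bar R), (forall i, nnmf (h i)) ->
    J (fun x => \sum_(i <- s) h i x) = \sum_(i <- s) J (h i)) ->
  (0 <= M)%R -> (forall j, J (iter j P L) <= M%:E) ->
  forall N n (eps : R), (0 < N)%N -> (n <= N)%N -> (0 < eps)%R ->
  J (fun x => iter n SP (exceeds (eps * N%:R)) (x, 0%R)) <=
  (2 * K * M * eps `^ (- r) * N%:R `^ (- (r / 2)))%:E.
Proof.
have [K [K0 HK]] := tail_rate; exists K; split=> // J M J_le JZ J_sum M0 JM.
move=> N n eps N0 nN e0; have t0 : (0 < eps * N%:R)%R by rewrite mulr_gt0// ltr0n.
set a := ((eps * N%:R) `^ (- r) * (K * N%:R `^ (r / 2 - 1)))%R.
have a0 : (0 <= a)%R by rewrite !mulr_ge0// powR_ge0.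
have nP j : nnmf (iter j P L) by exact: nnmf_iter_trans.
have nS : nnmf (step_moment_sum mu f G V r N) by exact: nnmf_sum.
apply: (@le_trans _ _ (J (fun x => a%:E * step_moment_sum mu f G V r N x))).
  apply: J_le; [|exact: nnmfZ|by move=> x; exact: HK].
  by apply: nnmf_sum_start => //; exact: nnmf_exceeds.
rewrite JZ// J_sum//.
apply: (@le_trans _ _ (a%:E * (M * N.+1%:R)%:E)).
  apply: lee_wpmul2l; first by rewrite lee_fin.
  apply: (@le_trans _ _ (\sum_(0 <= j < N.+1) M%:E)); first exact: lee_sum.
  by rewrite sumEFin lee_fin sumr_const_nat subn0 mulr_natr.
rewrite -EFinM lee_fin /a.
have -> : ((eps * N%:R) `^ (- r) * (K * N%:R `^ (r / 2 - 1)) * (M * N.+1%:R) =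
  K * M * ((eps * N%:R) `^ (- r) * N%:R `^ (r / 2 - 1) * N.+1%:R))%R by ring.
have -> : (2 * K * M * eps `^ (- r) * N%:R `^ (- (r / 2)) =
  K * M * (2 * eps `^ (- r) * N%:R `^ (- (r / 2))))%R by ring.
by apply: ler_wpM2l; [exact: mulr_ge0|exact: rate_le].
Qed.

Let nVr : nnmf (fun x => (V x `^ r)%:E).
Proof.
apply: nnmf_EFin; last by move=> x; exact: powR_ge0.
exact: (measurableT_comp (measurable_powR r) mV).
Qed.

(** Centring adds a constant, which is absorbed since [V] is at least 1. *)
Lemma step_moment_centred_le x : L x <=
  (2 `^ r)%:E * incr_moment mu f r g x +
  (2 `^ r * `|I| `^ r + 1)%:E * (V x `^ r)%:E.
Proof.
have r0 : (0 <= r)%R by have := r2; lra.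
have Vr1 : (1 <= V x `^ r)%R.
  by rewrite -[leLHS](one_powR r) ge0_ler_powR// nnegrE.
have p0 : (0 <= 2 `^ r)%R by exact: powR_ge0.
have p1 : (0 <= 2 `^ r * `|I| `^ r)%R by rewrite mulr_ge0 ?powR_ge0.
have nf : nnmf (fun y => (f y x)%:E) by apply: nnmf_EFin => // y; exact: df.2.
have ng := nnmfM nf (nnmf_incr_slice r x mg).
rewrite /step_moment EFinD ge0_muleDl ?lee_fin// mul1e addeA leeD2r//.
apply: (@le_trans _ _ (\int[mu]_y ((2 `^ r)%:E * ((f y x)%:E * (`|g y x| `^ r)%:E) +
    (2 `^ r * `|I| `^ r)%:E * (f y x)%:E))).
  apply: nn_le_integral.
  - exact: nnmfM nf (nnmf_incr_slice r x mG).
  - by apply: nnmfD; exact: nnmfZ.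
  move=> y; rewrite -!EFinM -!EFinD lee_fin.
  have h := normD_powR_le2 (g y x) (- I) r0; rewrite normrN in h.
  have := ler_wpM2l (df.2 y x) h; rewrite /centred => {}h; apply: (le_trans h).
  by rewrite le_eqVlt; apply/orP; left; apply/eqP; ring.
rewrite nn_integralD//; [|exact: nnmfZ..].
rewrite !nn_integralZ//; case: tf => _ _ ->; rewrite mule1 leeD2l//.
by rewrite -EFinM lee_fin ler_peMr.
Qed.

Lemma iter_step_moment_integral_le (d' : measure_display)
    (Om : measurableType d') (Pr : probability Om R) (Y : {mfun Om >-> T})
    (M1 M2 : R) j :
  \int[Pr]_w iter j P (incr_moment mu f r g) (Y w) <= M1%:E ->
  \int[Pr]_w iter j P (fun x => (V x `^ r)%:E) (Y w) <= M2%:E ->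
  \int[Pr]_w iter j P L (Y w) <=
  (2 `^ r * M1 + (2 `^ r * `|I| `^ r + 1) * M2)%:E.
Proof.
move=> h1 h2.
have p0 : (0 <= 2 `^ r)%R by exact: powR_ge0.
have p1 : (0 <= 2 `^ r * `|I| `^ r + 1)%R by rewrite addr_ge0// mulr_ge0 ?powR_ge0.
have ng : nnmf (incr_moment mu f r g) by exact: nnmf_incr_moment.
have nY (h : T -> \bar R) : nnmf h -> nnmf (fun w => h (Y w)) by exact: nnmf_comp.
have nPg := nnmf_iter_trans tf j ng.
have nPV := nnmf_iter_trans tf j nVr.
apply: (@le_trans _ _ (\int[Pr]_w (
    (2 `^ r)%:E * iter j P (incr_moment mu f r g) (Y w) +
    (2 `^ r * `|I| `^ r + 1)%:E * iter j P (fun x => (V x `^ r)%:E) (Y w)))).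
  apply: nn_le_integral.
  - exact: nY (nnmf_iter_trans tf j nL).
  - exact: nY (nnmfD (nnmfZ p0 nPg) (nnmfZ p1 nPV)).
  move=> w; rewrite -(iter_kopZ mu df measurable_snd j _ p0 ng).
  rewrite -(iter_kopZ mu df measurable_snd j _ p1 nVr).
  rewrite -(iter_kopD mu df measurable_snd j _ (nnmfZ p0 ng) (nnmfZ p1 nVr)).
  apply: (iter_kop_le mu df measurable_snd j _ nL (nnmfD (nnmfZ p0 ng) (nnmfZ p1 nVr))).
  exact: step_moment_centred_le.
rewrite (nn_integralD _ (nY _ (nnmfZ p0 nPg)) (nY _ (nnmfZ p1 nPV))).
rewrite (nn_integralZ _ p0 (nY _ nPg)) (nn_integralZ _ p1 (nY _ nPV)).
have -> : (2 `^ r * M1 + (2 `^ r * `|I| `^ r + 1) * M2)%:E =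
  (2 `^ r)%:E * M1%:E + (2 `^ r * `|I| `^ r + 1)%:E * M2%:E by [].
by apply: leeD; apply: lee_wpmul2l; rewrite ?lee_fin.
Qed.

Lemma centred_norm_integral x :
  \int[mu]_y ((f y x)%:E * (`|G y x|)%:E) <= ((B + `|I|) * V x)%:E.
Proof.
have nf : nnmf (fun y => (f y x)%:E) by apply: nnmf_EFin => // y; exact: df.2.
have mgx (h : T -> T -> R) : measurable_fun setT (fun z : T * T => h z.1 z.2) ->
    nnmf (fun y => (`|h y x|)%:E).
  move=> mh; apply: nnmf_EFin => //; apply: (measurableT_comp (@normr_measurable R setT)).
  apply: (measurableT_comp mh (g := fun y => (y, x))).
  by apply: measurable_fun_pair => //; exact: measurable_cst.
have n1 := nnmfM nf (mgx _ mg).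
have n2 : nnmf (fun y => (`|I|)%:E * (f y x)%:E) by exact: nnmfZ.
apply: (@le_trans _ _ (\int[mu]_y ((f y x)%:E * (`|g y x|)%:E +
    (`|I|)%:E * (f y x)%:E))).
  apply: nn_le_integral; [exact: nnmfM (mgx _ mG)|exact: nnmfD|move=> y].
  rewrite -!EFinM -!EFinD lee_fin [(`|I| * _)%R]mulrC -mulrDr.
  by rewrite ler_wpM2l ?df.2// /centred ler_normB.
rewrite nn_integralD// nn_integralZ//; case: tf => _ _ ->; rewrite mule1.
apply: (@le_trans _ _ ((B * V x)%:E + (`|I|)%:E)); first by rewrite leeD2r.
by rewrite -EFinD lee_fin mulrDl lerD2l ler_peMr.
Qed.

(** A single law with finite [V]-moment at time 0 needs no further moments. The
    moments of order [r] are only used after a regeneration; the law of [Y]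
    supplies them. *)
Lemma summable_tails (d' : measure_display) (Om : measurableType d')
    (Pr : probability Om R) (Y : {mfun Om >-> T}) (M : R) (eps : R) :
  \int[Pr]_w (V (Y w))%:E < +oo ->
  (forall j, \int[Pr]_w iter j P L (Y w) <= M%:E) -> (0 < eps)%R ->
  exists c k : R, forall i x, (0 <= c)%R /\
    \sum_(0 <= l < i) iter l SP (exceeds (eps * l%:R)) (x, 0%R) <= (c * V x + k)%:E.
Proof.
move=> VY LM e0.
have [M' [M'0 regM]] := regen_moment gd VY nL LM.
have [K [K0 HK]] := functional_rate.
have mC := gd_measurable_set gd.
have m0 := gd_minor_gt0 gd.
have e20 : (0 < eps / 2)%R by rewrite divr_gt0.
pose q : R := (2 * K * M' * (eps / 2) `^ (- r))%R.
have q0 : (0 <= q)%R by rewrite !mulr_ge0// powR_ge0.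
have hrg := HK rg M' (@regen_le _ _ _ _ _ mC _ m0) (@regenZ _ _ _ _ _ mC _ m0)
  (@regen_sum _ _ _ _ _ mC _ m0 nat) M'0 regM.
have s1 : (1 < r / 2)%R by have := r2; lra.
have delta0 := regen_mass_gt0 gd lambda_inv.
pose Kap : R := (q * (1 + (r / 2 - 1)^-1) / regen_mass mu C m)%R.
have Kap0 : (0 <= Kap)%R.
  apply: divr_ge0; last exact: ltW.
  by rewrite mulr_ge0// addr_ge0// invr_ge0; lra.
have rt j i : rg (half_tails mu f G eps j.+1 i) <= (Kap * regen_mass mu C m)%:E.
  have nh l : nnmf (fun y => iter l SP (exceeds (eps / 2 * (j.+1 + l)%:R)) (y, 0%R)).
    by apply: nnmf_sum_start => //; exact: nnmf_exceeds.
  rewrite /half_tails regen_sum// divfK ?gt_eqF//.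
  apply: (@le_trans _ _ (\sum_(0 <= l < i) (q * l.+1%:R `^ (- (r / 2)))%:E)).
    apply: lee_sum => l _; apply: le_trans (hrg (j.+1 + l)%N l _ _ _ e20) _ => //.
      by rewrite leq_addl.
    rewrite lee_fin -/q ler_wpM2l// powRN_decreasing//; first lra.
    by rewrite ler_nat addSn ltnS leq_addl.
  rewrite sumEFin lee_fin -mulr_sumr ler_wpM2l//.
  exact: sum_powRN_bound.
have BI : (0 <= B + `|I|)%R by exact: addr_ge0.
have tl := tails_le gd lambda_inv mG BI centred_norm_integral e0 Kap0 rt 0.
exists ((1 + 2 / eps * (B + `|I|)) *
  ((1 + D / regen_mass mu C m) / rho))%R, Kap => i x.
have c10 : (0 <= 1 + 2 / eps * (B + `|I|))%R.
  by rewrite addr_ge0// mulr_ge0// divr_ge0// ltW.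
have /andP[rho0 _] := gd_rate gd.
split.
  rewrite mulr_ge0// divr_ge0 ?(ltW rho0)// addr_ge0//.
  by rewrite divr_ge0 ?(ltW delta0) ?(ltW (gd_const_gt0 gd)).
apply: le_trans (tl i (x, 0%R)) _.
rewrite lee_fin /tails_bound /= normr0 mulr0 add0r lerD2r -[leRHS]mulrA.
apply: ler_wpM2l => //; exact: (potential_le_V gd lambda_inv).
Qed.

End rate.

(** * The change-point model *)

(** The integral of a nonnegative function is a supremum over the simple
    functions below it, whether or not the function is measurable. *)
Lemma ge0_le_integral_any (d : measure_display) (T : measurableType d)
    (R : realType) (mu : {measure set T -> \bar R}) (F G : T -> \bar R) :
  (forall x, 0 <= F x) -> (forall x, F x <= G x) ->
  \int[mu]_x F x <= \int[mu]_x G x.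
Proof.
move=> F0 FG; have G0 x : 0 <= G x by exact: le_trans (FG x).
rewrite !ge0_integralTE//; apply: ereal_sup_le => _ [h hF <-].
by exists h => // x;
  apply: le_trans (FG x); exact: hF.
Qed.

Lemma lty_le_EFin (R : realType) (x : \bar R) : x < +oo ->
  exists M : R, (0 <= M)%R /\ x <= M%:E.
Proof.
case: x => [s _|//|_]; last by exists 0%R; rewrite leNye.
by exists (Num.max s 0)%R; rewrite lee_fin !le_max !lexx orbT.
Qed.

Section started_chain.
Context (d d' : measure_display) (T : measurableType d) (R : realType)
  (mu : {sigma_finite_measure set T -> \bar R}) (f : T -> T -> R)
  (tf : transition_density mu f) (Om : measurableType d')
  (X : nat -> {mfun Om >-> T}) (Px : T -> probability Om R)
  (HPx : forall x, markov_law mu (Px x) X (\d_x) (fun=> f)).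

Let tp (n : nat) : transition_density mu ((fun=> f) n : T -> T -> R).
Proof. exact: tf. Qed.

Lemma started_trans x n (F : T -> \bar R) : nnmf F ->
  \int[Px x]_w F (X n w) = iter n (trans mu f) F x.
Proof.
move=> nF; have nPF := nnmf_iter_trans tf n nF.
rewrite (process_trans tp (HPx x) (k := 0) (f := f) _ nF)//.
rewrite (process_init (HPx x) (m := \d_x) _ nPF)//.
rewrite integral_dirac//; last by case: nPF.
by rewrite diracT mul1e.
Qed.

Lemma started_increment x n (g : T -> T -> R) (r : R) :
  measurable_fun setT (fun z : T * T => g z.1 z.2) ->
  \int[Px x]_w (`|g (X n.+1 w) (X n w)| `^ r)%:E =
  iter n (trans mu f) (incr_moment mu f r g) x.
Proof.
move=> mg; rewrite -started_trans; last exact: nnmf_incr_moment.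
rewrite (markov_step tp (HPx x) (n := n) (H := X n)
  (Phi := fun z : T * T => (`|g z.2 z.1| `^ r)%:E))//; last exact: nnmf_incr_pow.
move=> A mA; rewrite -[X in history _ _ X]setTI.
by apply: sub_sigma_algebra; exists n => /=; [exact: leqnn|exists A].
Qed.

Lemma iter_le_gstar x n (g : T -> T -> R) (r : R) :
  measurable_fun setT (fun z : T * T => g z.1 z.2) ->
  iter n (trans mu f) (incr_moment mu f r g) x <= gstar Px X g r x.
Proof.
move=> mg; rewrite -started_increment//; apply: ereal_sup_ubound.
by exists n.+1 => //; rewrite unlock.
Qed.

Lemma iter_le_upsilonstar x n (V : T -> R) (r : R) : measurable_fun setT V ->
  iter n (trans mu f) (fun y => (V y `^ r)%:E) x <= upsilonstar Px X V r x.
Proof.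
move=> mV; rewrite -started_trans.
  by apply: ereal_sup_ubound; exists n => //; rewrite unlock.
apply: nnmf_EFin; last by move=> y; exact: powR_ge0.
exact: (measurableT_comp (measurable_powR r) mV).
Qed.

End started_chain.

Section change_point.
Context (d d' : measure_display) (T : measurableType d) (R : realType)
  (mu : {sigma_finite_measure set T -> \bar R}) (f0 f1 : T -> T -> R)
  (t0 : transition_density mu f0) (t1 : transition_density mu f1)
  (Om : measurableType d') (X : nat -> {mfun Om >-> T})
  (pi0 : probability T R) (P : option nat -> probability Om R)
  (HP : forall nu, markov_law mu (P nu) X pi0 (change_density f0 f1 nu)).

Lemma change_transition nu n : transition_density mu (change_density f0 f1 nu n).
Proof. by case: nu => [k|] //=; case: ifP. Qed.

(** The first [k] transitions are the same under both laws. *)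
Lemma change_law k (F : T -> \bar R) : nnmf F ->
  \int[P (Some k)]_w F (X k w) = \int[P None]_w F (X k w).
Proof.
move=> nF; have nPF := nnmf_iter_trans t0 k nF.
rewrite (process_trans (change_transition _) (HP (Some k)) (k := 0) (f := f0) _ nF);
  last by move=> i ik; rewrite /= add0n ik.
rewrite (process_trans (change_transition _) (HP None) (k := 0) (f := f0) _ nF)//.
rewrite (process_init (HP (Some k)) (m := pi0) _ nPF)//.
by rewrite (process_init (HP None) (m := pi0) _ nPF).
Qed.

Lemma tail_event (g : T -> T -> R) (I eps : R) k n :
  measurable_fun setT (fun z : T * T => g z.1 z.2) -> (0 < n)%N ->
  P (Some k) [set w | (`|n%:R^-1 * Zsum g X k (k + n) w - I| > eps)%R] =
  \int[P (Some k)]_w iter n (sum_trans mu f1 (fun y x => (g y x - I)%R))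
    (exceeds (eps * n%:R)) (X k w, 0%R).
Proof.
move=> mg n0; pose G y x := (g y x - I)%R.
have mG : measurable_fun setT (fun z : T * T => G z.1 z.2).
  by apply: measurable_funB => //; exact: measurable_cst.
rewrite -(process_state (change_transition _) (HP (Some k)) mG); last 2 first.
- by move=> i _ /=; rewrite ltnNge leq_addr.
- exact: nnmf_exceeds.
pose S w := (\sum_(i < n) G (X (k + i).+1 w) (X (k + i)%N w))%R.
have mS : measurable_fun setT S.
  apply: measurable_sum => i.
  apply: (measurableT_comp mG (g := fun w => (X (k + i).+1 w, X (k + i)%N w))).
  exact: measurable_fun_pair.
have nn : (0 < n%:R :> R)%R by rewrite ltr0n.
rewrite [X in P _ X](_ : _ = [set w | (eps * n%:R < `|S w|)%R]); last first.
  apply/seteqP; suff H w : (eps < `|n%:R^-1 * Zsum g X k (k + n) w - I|)%R =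
      (eps * n%:R < `|S w|)%R by split=> w /=; rewrite H.
  have -> : (n%:R^-1 * Zsum g X k (k + n) w - I = n%:R^-1 * S w)%R.
    rewrite /S /G sumrB sumr_const card_ord -[(I *+ n)%R]mulr_natl.
    rewrite [RHS]mulrBr mulKf ?gt_eqF//; congr (_ * _ - _)%R.
    rewrite /Zsum -addSn -{1}[k.+1]add0n big_addn addKn big_mkord.
    by apply: eq_bigr => i _; rewrite addnS /= addnC.
  by rewrite normrM gtr0_norm ?invr_gt0// mulrC ltr_pdivlMr.
rewrite -[X in P _ X]setIT -integral_indic//; last first.
  rewrite (_ : [set w | _] = ~` [set w | (`|S w| <= eps * n%:R)%R]); last first.
    by apply/seteqP; split=> w /=; [move/lt_geF => ->|move/negP; rewrite -ltNge].
  apply: measurableC; rewrite -[X in measurable X]setTI.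
  apply: measurable_fun_le => //.
  exact: (measurableT_comp (@normr_measurable R setT) mS).
Qed.

End change_point.

Local Close Scope ereal_scope.

Theorem theorem9 (R : realType) (d d' : measure_display)
  (T : measurableType d) (mu : {sigma_finite_measure set T -> \bar R})
  (f0 f1 : T -> T -> R)
  (Hf0 : transition_density mu f0) (Hf1 : transition_density mu f1)
  (Hf01 : forall x y, f0 y x = 0 <-> f1 y x = 0)
  (Om : measurableType d') (X : nat -> {mfun Om >-> T})
  (pi0 : probability T R)
  (P : option nat -> probability Om R)
  (HP : forall nu, markov_law mu (P nu) X pi0 (change_density f0 f1 nu))
  (Px : T -> probability Om R)
  (HPx : forall x, markov_law mu (Px x) X (\d_x) (fun=> f1))
  (lambda : probability T R)
  (Herg : positive_ergodic mu Px X f1 lambda)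
  (g : T -> T -> R) (Hg : g = llr f0 f1)
  (Hgt : forall x, mu.-integrable setT (fun y => (g y x * f1 y x)%:E))
  (HI : lambda.-integrable setT (fun x => (gtilde mu g f1 x)%:E))
  (C : set T) (mC : measurable C) (HC : (mu C < +oo)%E)
  (H11 : (0 < ereal_inf [set z | exists x y, [/\ C x, C y & z = (f1 y x)%:E]])%E)
  (V : T -> R) (mV : measurable_fun setT V) (V1 : forall x, 1 <= V x)
  (H12 : forall x, gtilde mu g f1 x <= V x)
  (H12' : (ereal_sup [set (V x)%:E | x in C] < +oo)%E)
  (rho D : R) (Hrho : 0 < rho < 1) (HD : 0 < D)
  (H13 : forall x,
    ('E_(Px x)[fun w => V (X 1%N w)] <= ((1 - rho) * V x + D * \1_C x)%:E)%E)
  (r : R) (Hr : 2 < r)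
  (Hgstar : (ereal_sup [set \int[P None]_w gstar Px X g r (X k w)
                       | k in [set k | (1 <= k)%N]] < +oo)%E)
  (Hustar : (ereal_sup [set \int[P None]_w upsilonstar Px X V r (X k w)
                       | k in [set k | (1 <= k)%N]] < +oo)%E)
  (HX0 : (\int[pi0]_x (V x)%:E < +oo)%E) :
  let I := \int[lambda]_x gtilde mu g f1 x in
  forall eps : R, 0 < eps ->
    (\sum_(1 <= n <oo)
       ereal_sup [set P (Some k)
                    [set w | (`|n%:R^-1 * Zsum g X k (k + n) w - I| > eps)%R]
                 | k in [set: nat]] < +oo)%E.
Proof.
subst g; pose g := llr f0 f1; rewrite -/g in Hgt HI H12 Hgstar *.
move=> I eps e0.
have mg : measurable_fun setT (fun z : T * T => g z.1 z.2).
  exact: measurable_llr Hf0 Hf1 Hf01.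
pose gt := gtilde mu g f1.
have gt0 x : 0 <= gt x.
  exact: (gtilde_ge0 Hf0 Hf1 Hf01).
have gtV x : 0 <= gt x <= V x by rewrite gt0 /=; exact: H12.
have mgt : measurable_fun setT gt by apply/measurable_EFinP; case/integrableP: HI.
have gtE x : (\int[mu]_y (g y x * f1 y x)%:E = (gt x)%:E)%E by exact: gtildeE.
(* the infimum over an empty [C] is [+oo]; any [m] will do then *)
have [m [m0 fm]] : exists m : R, 0 < m /\ forall x y, C x -> C y -> m <= f1 y x.
  move: H11; set s := ereal_inf _.
  have sle x y : C x -> C y -> (s <= (f1 y x)%:E)%E.
    by move=> Cx Cy; apply: ereal_inf_lbound; exists x, y.
  case: s sle => [s sle s0|sle _|//]; first by exists s.
  by exists 1; split=> // x y Cx Cy; have := sle x y Cx Cy.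
have drift x : (trans mu f1 (EFin \o V) x <= ((1 - rho) * V x + D * \1_C x)%:E)%E.
  have nV : nnmf (EFin \o V).
    by apply: nnmf_EFin => // y; exact: le_trans (V1 y).
  apply: le_trans (H13 x); rewrite unlock.
  by have /= <- := started_trans Hf1 HPx x 1 nV.
have gd : geometric_drift mu f1 C m rho D V.
  exact: (GeometricDrift Hf1 mC HC m0 fm mV V1 Hrho HD drift).
have lambda_inv := Herg.1.
have gB x : (\int[mu]_y ((f1 y x)%:E * (`|g y x|)%:E) <= (3 * V x)%:E)%E.
  have h : (\int[mu]_y ((f1 y x)%:E * (`|g y x|)%:E) <= (gt x + 2)%:E)%E.
    exact: (norm_llr_integral Hf0 Hf1 Hf01).
  apply: (le_trans h); rewrite lee_fin.
  by have := V1 x; have := H12 x; rewrite -/(gt x); lra.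
pose G := centred lambda g gt.
have mG : measurable_fun setT (fun z : T * T => G z.1 z.2).
  exact: measurable_centred.
pose L := step_moment mu f1 G V r.
have [Mg [Mg0 HMg]] := lty_le_EFin Hgstar.
have [Mu [Mu0 HMu]] := lty_le_EFin Hustar.
pose M := 2 `^ r * Mg + (2 `^ r * `|I| `^ r + 1) * Mu.
have M0 : 0 <= M.
  by rewrite addr_ge0 ?mulr_ge0 ?addr_ge0 ?mulr_ge0 ?powR_ge0.
have ng : nnmf (incr_moment mu f1 r g) by exact: nnmf_incr_moment.
have nVr : nnmf (fun x => (V x `^ r)%:E).
  apply: nnmf_EFin; last by move=> x; exact: powR_ge0.
  exact: (measurableT_comp (measurable_powR r)).
have nX k (F : T -> \bar R) : nnmf F -> nnmf (fun w => F (X k w)).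
  by exact: nnmf_comp.
have Mgk k j : (0 < k)%N ->
    (\int[P None]_w iter j (trans mu f1) (incr_moment mu f1 r g) (X k w) <= Mg%:E)%E.
  move=> k0; apply: le_trans HMg.
  apply: (@le_trans _ _ (\int[P None]_w gstar Px X g r (X k w))%E).
    apply: ge0_le_integral_any => w; last exact: iter_le_gstar.
    by case: (nnmf_iter_trans Hf1 j ng).
  by apply: ereal_sup_ubound; exists k.
have Muk k j : (0 < k)%N ->
    (\int[P None]_w iter j (trans mu f1) (fun x => (V x `^ r)%:E) (X k w) <= Mu%:E)%E.
  move=> k0; apply: le_trans HMu.
  apply: (@le_trans _ _ (\int[P None]_w upsilonstar Px X V r (X k w))%E).
    apply: ge0_le_integral_any => w; last exact: iter_le_upsilonstar.
    by case: (nnmf_iter_trans Hf1 j nVr).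
  by apply: ereal_sup_ubound; exists k.
have LM k j : (0 < k)%N ->
    (\int[P None]_w iter j (trans mu f1) L (X k w) <= M%:E)%E.
  move=> k0; exact: (iter_step_moment_integral_le gd _ mg _ Hr (Mgk k j k0) (Muk k j k0)).
have VX1 : (\int[P None]_w (V (X 1%N w))%:E < +oo)%E.
  apply: (@le_lt_trans _ _ Mu%:E); last exact: ltry.
  apply: le_trans (Muk 1%N 0%N isT); apply: nn_le_integral.
  - by apply: (nX 1%N (EFin \o V)); apply: nnmf_EFin => // x; exact: le_trans (V1 x).
  - exact: (nX 1%N _ nVr).
  - by move=> w; rewrite lee_fin le1r_powR//; lra.
have [K [K0 HK]] := functional_rate gd lambda_inv mg Hgt mgt gtE gtV Hr.
have [c [k [c0 Hck]]] : exists c k : R, 0 <= c /\ forall i x,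
    (\sum_(0 <= l < i) iter l (sum_trans mu f1 G) (exceeds (eps * l%:R)) (x, 0%R)
     <= (c * V x + k)%:E)%E.
  have [c [k ck]] := summable_tails gd lambda_inv mg Hgt mgt gtE gtV
    (ler0n R 3) gB Hr VX1 (fun j => LM 1%N j isT) e0.
  by exists c, k; split=> [|i x]; [case: (ck 0%N point)|case: (ck i x)].
pose tail n w := iter n (sum_trans mu f1 G) (exceeds (eps * n%:R)) (w, 0%R).
have ntail n : nnmf (tail n).
  by apply: nnmf_sum_start => //; exact: nnmf_exceeds.
pose q : R := 2 * K * M * eps `^ (- r).
have q0 : 0 <= q by rewrite !mulr_ge0 ?powR_ge0.
pose b n : \bar R := ((q * n%:R `^ (- (r / 2)))%:E + \int[pi0]_x tail n x)%E.
(* for a change at [j > 0] the law of [X j] is the one without change, with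
   moments bounded uniformly in [j] *)
have late n j : (0 < n)%N -> (0 < j)%N ->
    (\int[P (Some j)]_w tail n (X j w) <= (q * n%:R `^ (- (r / 2)))%:E)%E.
  move=> n0 j0; rewrite (change_law Hf0 Hf1 HP)//.
  apply: (HK (fun h => (\int[P None]_w h (X j w))%E)) => //.
  - by move=> h h' nh nh' hh; apply: nn_le_integral => //; exact: (nX j).
  - by move=> s h s0 nh; rewrite -nn_integralZ//; exact: (nX j).
  - by move=> s h nh; rewrite -nn_integral_sum// => i; exact: (nX j _ (nh i)).
  - by move=> i; exact: LM.
(* a change at time 0 contributes a single law, and the maximum over the two
   cases is bounded by the sum *)
have supb n : (0 < n)%N -> (ereal_sup [set P (Some k0)
    [set w | (`|n%:R^-1 * Zsum g X k0 (k0 + n) w - I| > eps)%R]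
    | k0 in [set: nat]] <= b n)%E.
  move=> n0; apply: ge_ereal_sup => _ [j _ <-].
  rewrite (tail_event Hf0 Hf1 HP)// -/(tail n _).
  have t0 : (0 <= \int[pi0]_x tail n x)%E by exact: nn_integral_ge0.
  case: j => [|j].
    rewrite (process_init (HP (Some 0%N)) (m := pi0) _ (ntail n))//.
    by rewrite leeDr// lee_fin mulr_ge0 ?powR_ge0.
  by apply: le_trans (late n j.+1 n0 isT) _; rewrite leeDl.
have r21 : 1 < r / 2 by lra.
have V0 : (0 <= \int[pi0]_x (V x)%:E)%E.
  by apply: integral_ge0 => x _; rewrite lee_fin; exact: le_trans (V1 x).
have sumb N : (\sum_(1 <= n < N) b n <= (q * (1 + (r / 2 - 1)^-1))%:E +
    (c%:E * \int[pi0]_x (V x)%:E + (Num.max k 0)%:E))%E.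
  case: N => [|N].
    rewrite big_geq//; apply: adde_ge0.
      by rewrite lee_fin mulr_ge0// addr_ge0// invr_ge0; lra.
    by apply: adde_ge0; [rewrite mule_ge0 ?lee_fin|rewrite lee_fin le_max lexx orbT].
  rewrite big_split/=; apply: leeD.
    rewrite sumEFin lee_fin -mulr_sumr ler_wpM2l// big_add1.
    exact: sum_powRN_bound.
  apply: (@le_trans _ _ (\sum_(0 <= n < N.+1) \int[pi0]_x tail n x)%E).
    by rewrite [leRHS]big_ltn// leeDr//; exact: nn_integral_ge0.
  have nV : nnmf (EFin \o V) by apply: nnmf_EFin => // x; exact: le_trans (V1 x).
  have nk : nnmf (fun _ : T => (Num.max k 0)%:E).
    by apply: nnmf_cst; rewrite lee_fin le_max lexx orbT.
  rewrite -nn_integral_sum//.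
  apply: (@le_trans _ _ (\int[pi0]_x (c%:E * (V x)%:E + (Num.max k 0)%:E))%E).
    apply: nn_le_integral; [exact: nnmf_sum|exact: (nnmfD (nnmfZ c0 nV))|move=> x].
    apply: (le_trans (Hck N.+1 x)); rewrite -EFinM -EFinD lee_fin lerD2l.
    by rewrite le_max lexx.
  rewrite (nn_integralD _ (nnmfZ c0 nV) nk) (nn_integralZ _ c0 nV) leeD2l//.
  by rewrite integral_cst//= [X in (_ * X)%E]probability_setT mule1.
apply: (@le_lt_trans _ _ ((q * (1 + (r / 2 - 1)^-1))%:E +
    (c%:E * \int[pi0]_x (V x)%:E + (Num.max k 0)%:E))%E).
  apply: lime_le.
    apply: is_cvg_nneseries => n _ _.
    apply: le_trans (ereal_sup_ubound _); last by exists 0%N.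
    exact: measure_ge0.
  apply: nearW => N; apply: le_trans (sumb N).
  rewrite big_nat_cond [leRHS]big_nat_cond.
  by apply: lee_sum => n /andP[/andP[n0 _] _]; exact: supb.
apply: lte_add_pinfty; first exact: ltry.
apply: lte_add_pinfty; last exact: ltry.
by apply: lte_mul_pinfty; rewrite ?lee_fin.
Qed.
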